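(* Let $(R,\mathfrak m)$ be a complete local domain of prime characteristic $p>0$ and of dimension at least $2$, and let $I$ be an $\mathfrak m$-primary ideal. Then the function $s\mapsto e_s(I)$, $s\in(0,\infty)$, is constant if and only if $e_{\mathrm{HK}}(I)=e(I)$.
   Context: Local rings are commutative and Noetherian. Let $(R,\mathfrak m)$ be a local ring of prime characteristic $p>0$ and dimension $d$; $\lambda$ denotes length and $I^{[p^e]}$ is the ideal generated by the $p^e$-th powers of the elements of $I$. For $\mathfrak m$-primary ideals $I,J$ and real $s>0$ put $h_s(I,J)=\lim_{e\to\infty}\lambda\big(R/(I^{\lceil sp^e\rceil}+J^{[p^e]})\big)/p^{ed}$ (this limit exists), $\mathcal H_s(d)=\sum_{i=0}^{\lfloor s\rfloor}\frac{(-1)^i}{d!}\binom{d}{i}(s-i)^d$, $e_s(I,J)=h_s(I,J)/\mathcal H_s(d)$ and $e_s(I)=e_s(I,I)$. $e(I)=\lim_{n\to\infty} d!\,\lambda(R/I^n)/n^d$ is the Hilbert-Samuel multiplicity and $e_{\mathrm{HK}}(I)=\lim_{e\to\infty}\lambda(R/I^{[p^e]})/p^{ed}$ is the Hilbert-Kunz multiplicity. *)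

(* Defs.v *)
From mathcomp Require Export all_boot all_order all_algebra.
From mathcomp Require Export ring_quotient.
From mathcomp Require Export all_classical all_reals all_analysis.

Set Implicit Arguments.
Unset Strict Implicit.
Unset Printing Implicit Defensive.

Import Order.TTheory GRing.Theory Num.Theory.
Import numFieldNormedType.Exports.

Local Open Scope classical_set_scope.
Local Open Scope ring_scope.

Section Ideals.
Variable A : comNzRingType.
Implicit Types (I J P m : set A) (C : set (set A)).

(* The improper ideal [setT] is an [is_ideal]; MathComp's [idealr_closed], in
   contrast, characterizes the proper ideals. *)
Definition is_ideal I : Prop :=
  GRing.submod_closed ([in I] : {pred A^o}).

Definition is_proper_ideal I : Prop := idealr_closed [in I].

Definition is_prime_ideal P : Prop :=
  is_proper_ideal P /\ prime_idealr_closed [in P].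

Definition is_maximal_ideal m : Prop :=
  is_proper_ideal m /\
  forall J, is_proper_ideal J -> m `<=` J -> J = m.

Definition ideal_gen (S : set A) : set A := smallest is_ideal S.

Definition ideal_sum I J : set A := [set x + y | x in I & y in J].

Definition ideal_mul I J : set A := ideal_gen [set x * y | x in I & y in J].

Definition ideal_pow I (n : nat) : set A := iter n (ideal_mul I) setT.

(* For [q = p ^ e] this is the Frobenius power I^[q]. *)
Definition frobenius_pow I (q : nat) : set A := ideal_gen [set x ^+ q | x in I].

Definition radical I : set A := [set x | exists n : nat, I (x ^+ n)].

Definition is_primary_ideal I : Prop :=
  is_proper_ideal I /\ forall x y, I (x * y) -> I x \/ radical I y.

(* I is m-primary *)
Definition is_primary_to m I : Prop := is_primary_ideal I /\ radical I = m.

Definition noetherian : Prop :=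
  forall I, is_ideal I -> exists s : seq A, I = ideal_gen [set` s].

(* m is the unique maximal ideal of A *)
Definition is_local_at m : Prop :=
  is_maximal_ideal m /\ forall J, is_maximal_ideal J -> J = m.

Definition adic_cauchy m (u : nat -> A) : Prop :=
  forall n : nat, exists N : nat, forall i j : nat,
    (N <= i)%N -> (N <= j)%N -> ideal_pow m n (u i - u j).

Definition adic_cvg m (u : nat -> A) (l : A) : Prop :=
  forall n : nat, exists N : nat, forall i : nat,
    (N <= i)%N -> ideal_pow m n (u i - l).

Definition adically_complete m : Prop :=
  \bigcap_n ideal_pow m n = [set 0] /\
  forall u, adic_cauchy m u -> exists l, adic_cvg m u l.

(* There are c 0 `<` c 1 `<` ... `<` c k, all in C (k is the number of
   strict inclusions). *)
Definition has_chain C (k : nat) : Prop :=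
  exists c : nat -> set A,
    (forall i, (i <= k)%N -> C (c i)) /\
    (forall i, (i < k)%N -> c i `<` c i.+1).

Definition max_chain_length C (n : nat) : Prop :=
  has_chain C n /\ forall k, has_chain C k -> (k <= n)%N.

Definition is_krull_dim (d : nat) : Prop := max_chain_length is_prime_ideal d.

(* The length of the A-module A / I, whose submodules correspond to the ideals
   of A containing I. If this length is infinite, the value is 0. *)
Definition length_quot I : nat :=
  xget 0%N (max_chain_length [set J | is_ideal J /\ I `<=` J]).

End Ideals.

(* In this section p and d stand for the characteristic and the Krull dimension
   of A; the real-valued limits take values in an arbitrary model K of the
   real numbers. *)
Section Multiplicities.
Variables (K : realType) (A : comNzRingType) (p d : nat).
Implicit Types (I J : set A) (s : K).

(* The absolute value only casts the ceiling, nonnegative for s > 0, to nat. *)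
Definition h_mult I J s : K :=
  limn (fun e : nat =>
    (length_quot (ideal_sum (ideal_pow I `|Num.ceil (s * (p ^ e)%:R)|%N)
                            (frobenius_pow J (p ^ e))))%:R
    / (p ^ (e * d))%:R : K).

(* [Num.truncn s] is the floor of s for s >= 0. *)
Definition H_norm s : K :=
  \sum_(0 <= i < (Num.truncn s).+1)
     (-1) ^+ i / (d`!)%:R * 'C(d, i)%:R * (s - i%:R) ^+ d.

Definition s_mult2 I J s : K := h_mult I J s / H_norm s.

Definition s_mult I s : K := s_mult2 I I s.

Definition hilbert_samuel_mult I : K :=
  limn (fun n : nat =>
    (d`!)%:R * (length_quot (ideal_pow I n))%:R / n%:R ^+ d : K).

Definition hilbert_kunz_mult I : K :=
  limn (fun e : nat =>
    (length_quot (frobenius_pow I (p ^ e)))%:R / (p ^ (e * d))%:R : K).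

End Multiplicities.

(* Main.v *)
Require Import Defs.
From mathcomp Require Import zify ring.
Import Order.TTheory GRing.Theory Num.Theory.
Import numFieldNormedType.Exports.

(** Write I = (x_1, ..., x_n) and order the exponent vectors of length n by the
    graded lexicographic order. Let l(a) be the length of F_(>= a) / F_(> a), where
    F_(> a) is generated by the monomials x^b with b > a. This quotient is cyclic,
    isomorphic to A / (F_(> a) : x^a), and these colon ideals grow when a does componentwise; so l is a
    nonincreasing function on N^n, bounded by the length of A / I
    ([lead_length_noninc], [lead_length_max]). Put

      f(q, N) = sum of l(a) over the a with entries below q and degree below N.

    The filtration gives length(A / I^N) = f(N, N) ([has_length_pow]). Modulo I^[q]
    the monomials outside of the box [0, q)^n disappear and the other steps of the
    filtration can only become shorter; so, if V(q, N) is the length of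
    A / (I^N + I^[q]), the difference f(q, N) - V(q, N) is nondecreasing in N and
    vanishes for N = 0 ([length_sub_boxsum], [length_le_boxsum]).

    The sums f(q, N) are understood up to O(q^(d-1)) ([boxsum_asymptotic]): the
    region under the graph of l is, up to lower dimensional pieces, a disjoint union
    of finitely many translates of d-dimensional coordinate orthants, whence
    f(q, N) = E c(q, N) + O(q^(d-1)), where c(q, N) counts the b in [0, q)^d of degree
    below N. This needs f(q, N) = O(q^d), that is length(A / I^N) = O(N^d), which
    follows from the existence of a system of d parameters ([parameters_exist],
    [length_pow_bound]). By inclusion-exclusion c(q, ceil(s q)) / q^d tends to H_d(s)
    ([cvg_boxcount]); this is where the normalizing factor comes from. Thus
    f(q, ceil(s q)) / q^d tends to E H_d(s), and in particular e(I) = E.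

    For s = 1 the ideal I^[q] is contained in I^(s q), so e_1(I) = e(I). For a large
    integer s the ideal I^(s q) is contained in I^[q] and H_d(s) = 1, so
    e_s(I) = e_HK(I). Hence if e_s(I) is constant then e_HK(I) = e(I).

    Conversely, for M >= N the monotonicity of f - V reads

      V(q, M) - (f(q, M) - f(q, N)) <= V(q, N) <= f(q, N).

    Take N = ceil(s q) and M = j q with j a large integer, so that V(q, M) is the
    length of A / I^[q]. If e_HK(I) = E, then after division by q^d the left hand side
    tends to E - (E - E H_d(s)) and the right hand side to E H_d(s). Therefore
    h_s(I) = E H_d(s), and e_s(I) = E for all s. This uses that the sequence defining
    e_HK(I) converges: if E is not 0, because a divergent sequence is given the limit
    0; if E = 0, because the sequence is dominated by f(q, j q) / q^d, which tends to 0
    ([hilbert_kunz_cvg]). *)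

Set Implicit Arguments.
Unset Strict Implicit.
Unset Printing Implicit Defensive.
Local Open Scope classical_set_scope.
Local Open Scope ring_scope.

(** * Ideals *)

Section IdealTheory.
Variable A : comNzRingType.
Implicit Types (I J X Y Z B S T : set A) (x y a : A).

Lemma is_idealP I : is_ideal I <->
  [/\ I 0, forall x y, I x -> I y -> I (x + y) & forall a x, I x -> I (a * x)].
Proof.
split=> [[I0 IL]|[I0 ID IM]].
  have E x : (x \in ([in I] : {pred A^o})) = (x \in I) by [].
  have IL' a x y : I x -> I y -> I (a * x + y).
    by move=> Ix Iy; apply: set_mem; apply: (IL a x y); exact: mem_set.
  have I0' : I 0 by exact: set_mem I0.
  split=> // [x y Ix Iy|a x Ix]; first by rewrite -[x]mul1r; exact: IL'.
  by rewrite -[_ * _]addr0; exact: IL'.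
split; first exact: mem_set.
by move=> a x y /set_mem Ix /set_mem Iy; apply: mem_set; apply: ID => //; exact: IM.
Qed.

Lemma ideal0 I : is_ideal I -> I 0. Proof. by case/is_idealP. Qed.
Lemma idealD I x y : is_ideal I -> I x -> I y -> I (x + y).
Proof. by case/is_idealP=> _ h _; exact: h. Qed.
Lemma idealM I a x : is_ideal I -> I x -> I (a * x).
Proof. by case/is_idealP=> _ _; exact. Qed.
Lemma idealMr I a x : is_ideal I -> I x -> I (x * a).
Proof. by rewrite mulrC; exact: idealM. Qed.
Lemma idealB I x y : is_ideal I -> I x -> I y -> I (x - y).
Proof. by move=> iI Ix Iy; rewrite -mulN1r; apply: idealD => //; exact: idealM. Qed.

Lemma ideal_setT : is_ideal (@setT A). Proof. exact/is_idealP. Qed.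

Lemma ideal_set0 : is_ideal [set (0 : A)].
Proof.
apply/is_idealP; split=> //= [x y -> ->|a x ->]; first by rewrite addr0.
by rewrite mulr0.
Qed.

Lemma ideal_eqT I : is_ideal I -> I 1 -> I = setT.
Proof.
move=> iI I1; apply/seteqP; split=> // x _.
by rewrite -[x]mulr1; exact: idealM.
Qed.

Lemma idealI I J : is_ideal I -> is_ideal J -> is_ideal (I `&` J).
Proof.
move=> iI iJ; apply/is_idealP; split=> [|x y [? ?] [? ?]|a x [? ?]].
- by split; exact: ideal0.
- by split; exact: idealD.
- by split; exact: idealM.
Qed.

Lemma ideal_genP S : is_ideal (ideal_gen S).
Proof.
apply/is_idealP; split=> [J [iJ _]|x y Sx Sy J [iJ SJ]|a x Sx J [iJ SJ]].
- exact: ideal0.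
- by apply: idealD => //; [exact: Sx|exact: Sy].
- by apply: idealM => //; exact: Sx.
Qed.

Lemma sub_ideal_gen S : S `<=` ideal_gen S.
Proof. exact: sub_smallest. Qed.

Lemma ideal_gen_sub S I : is_ideal I -> S `<=` I -> ideal_gen S `<=` I.
Proof. by move=> iI SI; exact: smallest_sub. Qed.

Lemma ideal_gen_le S T : S `<=` T -> ideal_gen S `<=` ideal_gen T.
Proof.
by move=> ST; apply: ideal_gen_sub (ideal_genP _) _; exact: subset_trans ST (@sub_ideal_gen _).
Qed.

Lemma ideal_sumP I J : is_ideal I -> is_ideal J -> is_ideal (ideal_sum I J).
Proof.
move=> iI iJ; apply/is_idealP; split.
- by exists 0; [exact: ideal0|exists 0; [exact: ideal0|rewrite addr0]].
- move=> _ _ [x Ix [y Jy <-]] [x' Ix' [y' Jy' <-]].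
  exists (x + x'); first exact: idealD.
  by exists (y + y'); [exact: idealD|rewrite addrACA].
- move=> a _ [x Ix [y Jy <-]]; exists (a * x); first exact: idealM.
  by exists (a * y); [exact: idealM|rewrite mulrDr].
Qed.

Lemma ideal_suml I J : is_ideal J -> I `<=` ideal_sum I J.
Proof. by move=> iJ x Ix; exists x => //; exists 0; [exact: ideal0|rewrite addr0]. Qed.

Lemma ideal_sumr I J : is_ideal I -> J `<=` ideal_sum I J.
Proof. by move=> iI x Ix; exists 0; [exact: ideal0|exists x => //; rewrite add0r]. Qed.

Lemma ideal_sum_sub I J Z :
  is_ideal Z -> I `<=` Z -> J `<=` Z -> ideal_sum I J `<=` Z.
Proof. by move=> iZ IZ JZ _ [x /IZ Zx [y /JZ Zy <-]]; exact: idealD. Qed.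

Lemma ideal_sumSS I J X Y :
  I `<=` X -> J `<=` Y -> ideal_sum I J `<=` ideal_sum X Y.
Proof. by move=> IX JY _ [x /IX Xx [y /JY Yy <-]]; exists x => //; exists y. Qed.

Lemma ideal_sum0 I : ideal_sum I [set 0] = I.
Proof.
apply/seteqP; split=> [_ [x Ix [_ -> <-]]|x Ix]; first by rewrite addr0.
by exists x => //; exists 0 => //; rewrite addr0.
Qed.

Lemma ideal_sum_absorb I J : is_ideal I -> is_ideal J -> I `<=` J -> ideal_sum I J = J.
Proof.
by move=> iI iJ IJ; apply/seteqP; split; [exact: ideal_sum_sub|exact: ideal_sumr].
Qed.

Lemma ideal_sum_absorbr I J : is_ideal I -> is_ideal J -> J `<=` I -> ideal_sum I J = I.
Proof.
by move=> iI iJ IJ; apply/seteqP; split; [exact: ideal_sum_sub|exact: ideal_suml].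
Qed.

Definition principal y : set A := [set a * y | a in setT].

Lemma ideal_principal y : is_ideal (principal y).
Proof.
apply/is_idealP; split.
- by exists 0 => //; rewrite mul0r.
- by move=> _ _ [a _ <-] [b _ <-]; exists (a + b) => //; rewrite mulrDl.
- by move=> c _ [a _ <-]; exists (c * a) => //; rewrite mulrA.
Qed.

Lemma principal_id y : principal y y. Proof. by exists 1 => //; rewrite mul1r. Qed.

Lemma principal_sub y I : is_ideal I -> I y -> principal y `<=` I.
Proof. by move=> iI Iy _ [a _ <-]; exact: idealM. Qed.

Definition colon I y : set A := [set a | I (a * y)].

Lemma ideal_colon I y : is_ideal I -> is_ideal (colon I y).
Proof.
move=> iI; apply/is_idealP; rewrite /colon; split=> /= [|a b Ia Ib|a b Ib].
- by rewrite mul0r; exact: ideal0.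
- by rewrite mulrDl; exact: idealD.
- by rewrite -mulrA; exact: idealM.
Qed.

Lemma mul_gen_sub S T Z : is_ideal Z ->
  (forall x y, S x -> T y -> Z (x * y)) ->
  forall x y, ideal_gen S x -> ideal_gen T y -> Z (x * y).
Proof.
move=> iZ h x y Sx Ty.
have : ideal_gen S `<=` colon Z y.
  apply: ideal_gen_sub; first exact: ideal_colon.
  move=> s Ss; rewrite /colon/= mulrC.
  suff : ideal_gen T `<=` colon Z s by exact.
  apply: ideal_gen_sub; first exact: ideal_colon.
  by move=> t Tt; rewrite /colon/= mulrC; exact: h.
exact.
Qed.

Lemma ideal_mul_sub I J Z : is_ideal Z ->
  (forall x y, I x -> J y -> Z (x * y)) -> ideal_mul I J `<=` Z.
Proof. by move=> iZ h; apply: ideal_gen_sub => // _ [x Ix [y Jy <-]]; exact: h. Qed.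

Lemma ideal_mul_mem I J x y : I x -> J y -> ideal_mul I J (x * y).
Proof. by move=> Ix Jy; apply: sub_ideal_gen; exists x => //; exists y. Qed.

Lemma ideal_powS I n : ideal_pow I n.+1 = ideal_mul I (ideal_pow I n).
Proof. by []. Qed.

Lemma ideal_powP I n : is_ideal (ideal_pow I n).
Proof. by case: n => [|n]; [exact: ideal_setT|exact: ideal_genP]. Qed.

Lemma ideal_pow_decS I n : ideal_pow I n.+1 `<=` ideal_pow I n.
Proof. by apply: ideal_mul_sub (ideal_powP _ _) _ => x y _ Iy; apply: idealM => //; exact: ideal_powP. Qed.

Lemma ideal_pow_dec I k n : (k <= n)%N -> ideal_pow I n `<=` ideal_pow I k.
Proof.
move=> /subnK <-; elim: (n - k)%N => [//|j IH].
by rewrite addSn; exact: subset_trans (@ideal_pow_decS _ _) IH.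
Qed.

Lemma ideal_pow_sub I J n : I `<=` J -> ideal_pow I n `<=` ideal_pow J n.
Proof.
move=> IJ; elim: n => [//|n IH]; rewrite !ideal_powS.
apply: ideal_mul_sub (ideal_genP _) _ => x y Ix Iy.
by apply: ideal_mul_mem; [exact: IJ|exact: IH].
Qed.

Lemma ideal_powD_sub I i j x y :
  ideal_pow I i x -> ideal_pow I j y -> ideal_pow I (i + j) (x * y).
Proof.
elim: i x => [|i IH] x Ix Iy; first by apply: idealM => //; exact: ideal_powP.
have : ideal_pow I i.+1 `<=` colon (ideal_pow I (i.+1 + j)) y; last exact.
apply: ideal_mul_sub; first by apply: ideal_colon; exact: ideal_powP.
move=> u v Iu Iv; rewrite /colon/= -mulrA.
by apply: ideal_mul_mem => //; exact: IH.
Qed.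

Lemma ideal_pow_mul I i j : ideal_pow I (i * j) `<=` ideal_pow (ideal_pow I i) j.
Proof.
elim: j => [//|j IH]; rewrite mulnS.
suff : forall k, ideal_pow I (i + k) `<=` ideal_mul (ideal_pow I i) (ideal_pow I k).
  move=> /(_ (i * j)%N) h; apply: subset_trans h _.
  apply: ideal_mul_sub (ideal_genP _) _ => x y Ix Iy.
  by apply: ideal_mul_mem => //; exact: IH.
move=> k; elim: i {IH} => [|i IH].
  by move=> x Ix; rewrite -[x]mul1r; exact: ideal_mul_mem.
rewrite addSn ideal_powS; apply: ideal_mul_sub (ideal_genP _) _ => x y Ix Iy.
have : ideal_mul (ideal_pow I i) (ideal_pow I k) `<=`
       colon (ideal_mul (ideal_pow I i.+1) (ideal_pow I k)) x.
  apply: ideal_mul_sub; first by apply: ideal_colon; exact: ideal_genP.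
  move=> u v Iu Iv; rewrite /colon/= mulrC mulrA.
  by apply: ideal_mul_mem => //; exact: ideal_mul_mem.
by rewrite mulrC; apply; exact: IH.
Qed.

End IdealTheory.

(** * Lengths of intervals of ideals *)

Section Chains.
Variable A : comNzRingType.
Implicit Types (C D : set (set A)).

Lemma max_chain_uniq C n n' :
  max_chain_length C n -> max_chain_length C n' -> n = n'.
Proof. by move=> [c h] [c' h']; apply/eqP; rewrite eqn_leq h // h'. Qed.

Lemma max_chain_exists C k0 b : has_chain C k0 ->
  (forall k, has_chain C k -> (k <= b)%N) ->
  exists2 n, (n <= b)%N & max_chain_length C n.
Proof.
move=> h0 hb.
have e : exists k, `[< has_chain C k >] by exists k0; exact/asboolP.
have b' k : `[< has_chain C k >] -> (k <= b)%N by move/asboolP; exact: hb.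
case: (ex_maxnP e b') => n /asboolP hn nmax; exists n; first exact: hb.
by split=> // k hk; apply: nmax; exact/asboolP.
Qed.

Lemma has_chain_map C D (f : set A -> set A) k :
  (forall J, C J -> D (f J)) ->
  (forall J J', C J -> C J' -> J `<` J' -> f J `<` f J') ->
  has_chain C k -> has_chain D k.
Proof.
move=> fC flt [c [cC clt]]; exists (f \o c); split=> i ik /=.
  exact/fC/cC.
by apply: flt; [exact/cC/ltnW|exact: cC|exact: clt].
Qed.

Lemma has_chain_sub C D k : C `<=` D -> has_chain C k -> has_chain D k.
Proof. by move=> CD; apply: (@has_chain_map _ _ id). Qed.

(** The repetitions of a weakly increasing sequence can be dropped, so the
    number of its strict steps is the length of a chain. *)
Lemma weak_chain C (c : nat -> set A) k :
  (forall i, (i <= k)%N -> C (c i)) ->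
  (forall i, (i < k)%N -> c i `<=` c i.+1) ->
  exists c' : nat -> set A, let r := (\sum_(i < k) `[< c i `<` c i.+1 >])%N in
    [/\ forall i, (i <= r)%N -> C (c' i), forall i, (i < r)%N -> c' i `<` c' i.+1
      & c' r = c k].
Proof.
elim: k => [|k IH] cC cle.
  by exists c; rewrite big_ord0; split.
case: IH => [i ik|i ik|c' /= [c'C c'lt c'k]]; [exact/cC/leqW|exact/cle/leqW|].
set r := (\sum_(i < k) `[< c i `<` c i.+1 >])%N in c'C c'lt c'k *.
rewrite big_ord_recr /= -/r; case: asboolP => [lt_ck|nlt_ck].
  rewrite addn1; exists (fun i => if (i <= r)%N then c' i else c k.+1); split.
  - by move=> i; case: ifP => [ir _|_ _]; [exact: c'C|exact: cC].
  - move=> i; rewrite ltnS => ir; rewrite ir; case: ltnP => [|ri]; first exact: c'lt.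
    have -> : i = r by apply/eqP; rewrite eqn_leq ir ri.
    by rewrite c'k.
  - by rewrite ltnn.
rewrite addn0; exists c'; split=> //; rewrite c'k.
apply/seteqP; split; first exact: cle.
by apply: contrapT => h; apply: nlt_ck; split=> //; exact: cle.
Qed.

End Chains.

Section Length.
Variable A : comNzRingType.
Implicit Types (I J X Y Z B S T : set A) (x y : A).

Definition between X Y : set (set A) := [set J | [/\ is_ideal J, X `<=` J & J `<=` Y]].

(** For ideals [X] and [Y] with [X `<=` Y]: the module [Y / X] has length [n]. *)
Definition has_length X Y n := max_chain_length (between X Y) n.

Lemma length_quotE X n : has_length X setT n -> length_quot X = n.
Proof.
move=> h; rewrite /length_quot.
have E : [set J | is_ideal J /\ X `<=` J] = between X setT.
  by apply/seteqP; split=> J [] // h1 h2; split.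
apply: xget_subset1; rewrite E //.
by move=> n1 n2 h1 h2; exact: max_chain_uniq h1 h2.
Qed.

Lemma has_chain0 X Y : is_ideal X -> X `<=` Y -> has_chain (between X Y) 0.
Proof. by move=> iX XY; exists (fun=> X); split=> // i _; split. Qed.

Lemma has_length_id X : is_ideal X -> has_length X X 0.
Proof.
move=> iX; split; first exact: has_chain0.
move=> [//|k] [c [cC clt]].
have [_ X0 _] := cC 0 isT; have [_ _ X1] := cC 1%N isT.
by have [_] := clt 0%N isT; case; exact: subset_trans X0.
Qed.

(** The form of the modular law from which the additivity of lengths follows. *)
Lemma modular_law J J' Y : is_ideal J -> is_ideal Y -> is_ideal J' -> J `<=` J' ->
  J' `&` Y `<=` J `&` Y -> ideal_sum J' Y `<=` ideal_sum J Y -> J' `<=` J.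
Proof.
move=> iJ iY iJ' JJ' hI hS x J'x.
have [u Ju [y Yy xE]] := hS x (@ideal_suml _ _ _ iY _ J'x).
have : (J' `&` Y) y.
  have yE : y = x - u by rewrite -xE; ring.
  by split=> //; rewrite yE; apply: idealB => //; exact: JJ'.
by move/hI => [Jy _]; rewrite -xE; exact: idealD.
Qed.

(** Lengths add up: intersecting a chain with [Y] and adding [Y] to it gives two
    weakly increasing sequences, and by the modular law each strict step of the
    chain remains strict in one of them. *)
Lemma has_lengthD X Y Z a b : is_ideal X -> is_ideal Y -> is_ideal Z ->
  X `<=` Y -> Y `<=` Z ->
  has_length X Y a -> has_length Y Z b -> has_length X Z (a + b).
Proof.
move=> iX iY iZ XY YZ [[c [cC clt]] amax] [[c' [cC' clt']] bmax]; split.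
  exists (fun i => if (i <= a)%N then c i else c' (i - a)%N); split=> i ib.
    case: ifP => ia.
      by have [ici Xc cY] := cC i ia; split=> //; exact: subset_trans YZ.
    have [|ici Yc cZ] := cC' (i - a)%N; first by lia.
    by split=> //; exact: subset_trans Yc.
  case: ltngtP => [ia|ia|ia].
  - exact: clt.
  - have -> : (i.+1 - a = (i - a).+1)%N by lia.
    by apply: clt'; lia.
  - have -> : (i.+1 - a = 1)%N by lia.
    have [_ _ cY] := cC i (eq_leq ia); have [_ Yc _] := cC' 0%N isT.
    have [l nl] : c' 0%N `<` c' 1%N by apply: clt'; lia.
    split; first by apply: subset_trans l; exact: subset_trans Yc.
    by move=> h; apply: nl; apply: subset_trans h _; exact: subset_trans Yc.
move=> k [e [eC elt]].
have [||e1 /= [e1C e1lt _]] := @weak_chain _ (between X Y) (fun i => e i `&` Y) k.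
- move=> i ik; have [iei Xe eZ] := eC i ik; split; first exact: idealI.
    by move=> x Xx; split; [exact: Xe|exact: XY].
  by move=> x [].
- by move=> i ik; apply: setSI; case: (elt i ik).
have [||e2 /= [e2C e2lt _]] := @weak_chain _ (between Y Z) (fun i => ideal_sum (e i) Y) k.
- move=> i ik; have [iei Xe eZ] := eC i ik; split; first exact: ideal_sumP.
    exact: ideal_sumr.
  exact: ideal_sum_sub.
- by move=> i ik; apply: ideal_sumSS => //; case: (elt i ik).
have := leq_add (amax _ (ex_intro _ e1 (conj e1C e1lt)))
                (bmax _ (ex_intro _ e2 (conj e2C e2lt))).
rewrite -big_split /=; apply: leq_trans; rewrite -{1}[k]card_ord -sum1_card.
apply: leq_sum => i _.
have [iei _ _] := eC i (ltnW (ltn_ord i)).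
have [iei1 _ _] := eC i.+1 (ltn_ord i).
have [le nle] := elt i (ltn_ord i).
case: asboolP => // h1; case: asboolP => // h2; case: nle.
apply: (@modular_law _ _ Y) => //.
  by apply: contrapT => h; apply: h1; split=> //; exact: setSI.
by apply: contrapT => h; apply: h2; split=> //; exact: ideal_sumSS.
Qed.

Lemma has_length_le X Y X' Y' n : is_ideal X' -> X' `<=` Y' ->
  X `<=` X' -> Y' `<=` Y -> has_length X Y n ->
  exists2 n', (n' <= n)%N & has_length X' Y' n'.
Proof.
move=> iX' XY' XX' YY' [_ nmax]; apply: max_chain_exists (has_chain0 iX' XY') _.
move=> k hk; apply: nmax; apply: has_chain_sub hk => J [iJ h1 h2]; split=> //.
  exact: subset_trans h1.
exact: subset_trans YY'.
Qed.

(** [(Y + B) / (X + B)] is a quotient of [Y / X]. *)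
Lemma has_length_addr X Y B n : is_ideal X -> is_ideal Y -> is_ideal B ->
  X `<=` Y -> has_length X Y n ->
  exists2 n', (n' <= n)%N & has_length (ideal_sum X B) (ideal_sum Y B) n'.
Proof.
move=> iX iY iB XY [_ nmax].
apply: max_chain_exists (has_chain0 (ideal_sumP iX iB) _) _.
  exact: ideal_sumSS.
move=> k hk; apply: nmax; apply: (@has_chain_map _ _ _ (fun J => J `&` Y)) hk.
  move=> J [iJ h1 h2]; split; first exact: idealI.
    move=> x Xx; split; last exact: XY.
    by apply: h1; exact: ideal_suml.
  by move=> x [].
move=> J J' [iJ h1 h2] [iJ' h1' h2'] [le nle]; split; first exact: setSI.
move=> h; apply: nle; apply: (@modular_law _ _ Y) => //.
apply: (@subset_trans _ (ideal_sum Y B)).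
  apply: ideal_sum_sub (ideal_sumP iY iB) h2' _; exact: ideal_suml.
apply: ideal_sum_sub (ideal_sumP iJ iY) _ _; first exact: ideal_sumr.
move=> b Bb; apply: ideal_suml => //; apply: h1; exact: ideal_sumr.
Qed.

Definition add_principal X y := ideal_sum X (principal y).

Lemma add_principalP X y : is_ideal X -> is_ideal (add_principal X y).
Proof. by move=> iX; apply: ideal_sumP iX (ideal_principal _). Qed.

Lemma sub_add_principal X y : X `<=` add_principal X y.
Proof. exact: ideal_suml (ideal_principal _). Qed.

Lemma add_principal_mem X y : is_ideal X -> add_principal X y y.
Proof. by move=> iX; apply: ideal_sumr => //; exact: principal_id. Qed.

(** [(X + A y) / X] is isomorphic to [A / (X : y)]; the two maps between the
    lattices of submodules are [J |-> J : y] and [K |-> X + K y]. *)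
Lemma has_length_colon X y n : is_ideal X ->
  has_length (colon X y) setT n <-> has_length X (add_principal X y) n.
Proof.
move=> iX.
have to_colon k : has_chain (between X (add_principal X y)) k ->
                  has_chain (between (colon X y) setT) k.
  apply: (@has_chain_map _ _ _ (fun J => colon J y)).
    by move=> J [iJ XJ JY]; split; [exact: ideal_colon|move=> x /XJ|].
  move=> J J' [iJ XJ JY] [iJ' XJ' JY'] [le nle]; split; first by move=> x /le.
  move=> h; apply: nle => x J'x.
  have [u Xu [_ [a _ <-] xE]] := JY' _ J'x.
  rewrite -xE; apply: idealD => //; first exact: XJ.
  apply: h; rewrite /colon/=.
  have -> : a * y = x - u by rewrite -xE; ring.
  by apply: idealB => //; exact: XJ'.
have of_colon k : has_chain (between (colon X y) setT) k ->
                  has_chain (between X (add_principal X y)) k.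
  have mem K : [set u + a * y | u in X & a in K] = ideal_sum X [set a * y | a in K].
    apply/seteqP; split=> [_ [u Xu [a Ka <-]]|_ [u Xu [_ [a Ka <-] <-]]].
      by exists u => //; exists (a * y) => //; exists a.
    by exists u => //; exists a.
  have iKy K : is_ideal K -> is_ideal [set a * y | a in K].
    move=> iK; apply/is_idealP; split=> [|_ _ [a Ka <-] [b Kb <-]|c _ [a Ka <-]].
    - by exists 0; rewrite ?mul0r//; exact: ideal0.
    - by exists (a + b); rewrite ?mulrDl//; exact: idealD.
    - by exists (c * a); rewrite ?mulrA//; exact: idealM.
  apply: (@has_chain_map _ _ _ (fun K => [set u + a * y | u in X & a in K])).
    move=> K [iK XK _]; rewrite mem; split.
    - by apply: ideal_sumP => //; exact: iKy.
    - by apply: ideal_suml; exact: iKy.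
    - by apply: ideal_sumSS => // _ [a _ <-]; exists a.
  move=> K K' [iK XK _] [iK' XK' _] [le nle]; split.
    by move=> _ [u Xu [a /le Ka <-]]; exists u => //; exists a.
  move=> h; apply: nle => a K'a.
  have [u Xu [b Kb E]] : [set u + a * y | u in X & a in K] (a * y).
    by apply: h; exists 0; [exact: ideal0|exists a => //; rewrite add0r].
  have : colon X y (a - b).
    by rewrite /colon/= mulrBl -E addrK.
  by move/XK => Kab; rewrite -(subrK b a); exact: idealD.
split=> -[ch mx]; split=> [|k hk].
- exact: of_colon.
- exact/mx/to_colon.
- exact: to_colon.
- exact/mx/of_colon.
Qed.

Lemma has_length_maximal m : is_maximal_ideal m -> is_ideal m -> has_length m setT 1.
Proof.
move=> [[m0 m1 _] mmax] im; have m1' : ~ m 1 by move/mem_set; exact/negP.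
split.
  exists (fun i => if i is 0 then m else setT); split.
    by case=> [|i] _; split=> //; exact: ideal_setT.
  by case=> // _; split=> // /(_ 1 I).
move=> [//|[//|k]] [c [cC clt]].
have [i1 m1l _] := cC 1%N isT; have [_ m0l _] := cC 0%N isT.
have [_ n01] := clt 0%N isT; have [_ n12] := clt 1%N isT.
have c1 : ~ c 1%N 1.
  by move=> c11; apply: n12; rewrite (ideal_eqT i1 c11).
case: n01; rewrite (mmax (c 1%N)) //; split.
- by apply: mem_set; exact: ideal0.
- by apply/negP=> /set_mem.
- by move=> a x y /set_mem ? /set_mem ?; apply: mem_set; apply: idealD => //; exact: idealM.
Qed.

End Length.

(** * Exponent vectors *)

Section Exponents.
Local Open Scope nat_scope.
Implicit Types (a b c : seq nat).

(** The exponent vectors of [n] variables with entries below [q] and total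
    degree below [N], enumerated by slices so that sums over them can be computed
    by induction on [n]. *)
Fixpoint box n q N : seq (seq nat) :=
  if n is n'.+1 then flatten [seq [seq t :: a | a <- box n' q (N - t)] | t <- iota 0 q]
  else if 0 < N then [:: [::]] else [::].

Lemma mem_box n q N a :
  (a \in box n q N) = [&& size a == n, all (fun t => t < q) a & sumn a < N].
Proof.
elim: n a N => [|n IH] a N /=; first by case: ifP => N0; case: a.
apply/flatten_mapP/idP => [[t]|].
  rewrite mem_iota add0n => /= tq /mapP[b]; rewrite IH => /and3P[/eqP sb qb Nb] ->.
  by rewrite /= sb eqxx tq qb /=; lia.
case: a => [//|t b] /= /and3P[sb /andP[tq qb] Nb].
exists t; first by rewrite mem_iota.
by apply: map_f; rewrite IH qb -eqSS sb /=; lia.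
Qed.

Lemma box_uniq n q N : uniq (box n q N).
Proof.
elim: n N => [|n IH] N /=; first by case: ifP.
apply: allpairs_uniq_dep => //; first exact: iota_uniq.
by move=> [t a] [t' a'] _ _ /= [-> ->].
Qed.

Lemma big_boxS n q N (f : seq nat -> nat) :
  \sum_(a <- box n.+1 q N) f a = \sum_(0 <= t < q) \sum_(a <- box n q (N - t)) f (t :: a).
Proof.
rewrite /= big_flatten big_map /index_iota subn0.
by apply: eq_bigr => t _; rewrite big_map.
Qed.

Definition layer n q N := [seq a <- box n q N.+1 | sumn a == N].

Lemma mem_layer n q N a :
  (a \in layer n q N) = [&& size a == n, all (fun t => t < q) a & sumn a == N].
Proof.
rewrite mem_filter mem_box; case: eqP => [->|_]; last by rewrite !andbF.
by rewrite ltnS leqnn.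
Qed.

Lemma big_box_layer n q N (f : seq nat -> nat) :
  \sum_(a <- box n q N.+1) f a = \sum_(a <- box n q N) f a + \sum_(a <- layer n q N) f a.
Proof.
rewrite (bigID (fun a => sumn a == N)) /= addnC -[in LHS]big_filter; congr (_ + _).
  apply: perm_big; apply: uniq_perm; rewrite ?filter_uniq ?box_uniq// => a.
  rewrite mem_filter !mem_box; case: (_ =P n); rewrite ?andbF//=.
  by case: all; rewrite ?andbF //= ltnS -ltn_neqAle.
by rewrite [RHS]big_filter.
Qed.

Lemma sumn_ge a t : t \in a -> t <= sumn a.
Proof.
elim: a => //= u a IH; rewrite inE => /orP[/eqP ->|/IH]; first exact: leq_addr.
by move=> h; apply: leq_trans h _; exact: leq_addl.
Qed.

Lemma sumn_all_lt q a : sumn a < q -> all (fun t => t < q) a.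
Proof. by move=> aq; apply/allP => t /sumn_ge ta; exact: leq_ltn_trans aq. Qed.

Lemma big_box_wide n q N (f : seq nat -> nat) : N <= q ->
  \sum_(a <- box n q N) f a = \sum_(a <- box n N N) f a.
Proof.
move=> Nq; apply: perm_big; apply: uniq_perm; rewrite ?box_uniq// => a.
rewrite !mem_box; congr (_ && _).
case: (ltnP (sumn a) N) => aN; rewrite ?andbF ?andbT//.
by rewrite !sumn_all_lt//; exact: leq_trans Nq.
Qed.

Lemma big_layer_box n q q' N (f : seq nat -> nat) : N < q' ->
  \sum_(a <- layer n q' N | all (fun t => t < q) a) f a = \sum_(a <- layer n q N) f a.
Proof.
move=> Nq; rewrite -big_filter; apply: perm_big.
apply: uniq_perm; rewrite ?filter_uniq ?box_uniq// => a.
rewrite mem_filter !mem_layer andbCA; congr (_ && _).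
case: eqP => [aN|_]; rewrite ?andbF// !andbT.
by rewrite [X in _ && X]sumn_all_lt ?andbT// aN.
Qed.

Fixpoint addv a b := match a, b with
  | x :: a', y :: b' => (x + y) :: addv a' b' | _, _ => [::] end.

Lemma size_addv a b : size a = size b -> size (addv a b) = size a.
Proof. by elim: a b => [|x a IH] [|y b] //= [/IH ->]. Qed.

Lemma sumn_addv a b : size a = size b -> sumn (addv a b) = sumn a + sumn b.
Proof. by elim: a b => [|x a IH] [|y b] //= [/IH ->]; rewrite addnACA. Qed.

(** The graded lexicographic order. That it is total and invariant under addition of
    exponents makes the filtration by larger monomials one with cyclic quotients on
    which monomials act. *)
Definition exp_lt a b :=
  (sumn a < sumn b) || (sumn a == sumn b) && ((a : seqlexi nat) < b)%O.

Lemma lexi_addv a b c : size a = size b -> size b = size c ->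
  ((a : seqlexi nat) < b)%O -> ((addv a c : seqlexi nat) < addv b c)%O.
Proof.
elim: a b c => [|x a IH] [|y b] [|z c] //= [sab] [sbc].
rewrite !Order.SeqLexiOrder.Exports.ltxi_cons !leEnat.
case/andP=> xy /implyP h; rewrite leq_add2r xy /= leq_add2r.
by apply/implyP => /h; exact: IH.
Qed.

Lemma exp_lt_addv a b c : size a = size b -> size b = size c ->
  exp_lt a b -> exp_lt (addv a c) (addv b c).
Proof.
move=> sab sbc; rewrite /exp_lt !sumn_addv ?sab// ltn_add2r eqn_add2r.
by case/orP=> [->//|/andP[-> h]]; rewrite lexi_addv ?orbT.
Qed.

Lemma leq_sumn_box q b : all (fun t => t < q) b -> sumn b <= size b * q.
Proof. by elim: b => //= t b IH /andP[tq /IH h]; rewrite mulSn; lia. Qed.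

End Exponents.

(** * The monomial filtration *)

Section Monomials.
Variable A : comNzRingType.
Implicit Types (xs : seq A) (a b c : seq nat) (I B : set A).

Fixpoint mono xs a : A :=
  match xs, a with x :: xs', t :: a' => x ^+ t * mono xs' a' | _, _ => 1 end.

Lemma monoD xs a b : size a = size xs -> size b = size xs ->
  mono xs (addv a b) = mono xs a * mono xs b.
Proof.
elim: xs a b => [|x xs IH] [|t a] [|u b] //=; first by rewrite mulr1.
by move=> [sa] [sb]; rewrite IH// exprD mulrACA.
Qed.

Lemma mono0 xs : mono xs (nseq (size xs) 0%N) = 1.
Proof. by elim: xs => //= x xs ->; rewrite mulr1. Qed.

Lemma mono_var xs x : x \in xs ->
  exists e, [/\ size e = size xs, sumn e = 1%N & mono xs e = x].
Proof.
elim: xs => //= y xs IH; rewrite inE => /orP[/eqP ->|/IH[e [se de <-]]].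
  exists (1%N :: nseq (size xs) 0%N).
  by rewrite /= size_nseq sumn_nseq mono0 expr1 mulr1.
by exists (0%N :: e); rewrite /= se de expr0 mul1r.
Qed.

Lemma mono_mem_pow xs I a N : is_ideal I -> {subset xs <= [in I]} ->
  size a = size xs -> (N <= sumn a)%N -> ideal_pow I N (mono xs a).
Proof.
move=> iI; elim: xs a N => [|x xs IH] [|t a] N //= xsI.
  by move=> _; rewrite leqn0 => /eqP ->.
move=> [sa] Na; have Ix : I x by apply: set_mem; apply: xsI; rewrite mem_head.
have Ixt : ideal_pow I t (x ^+ t).
  by elim: t {Na} => [//|t IHt]; rewrite exprS; exact: ideal_mul_mem.
apply: (@ideal_pow_dec _ _ _ (t + (N - t))); first by lia.
apply: ideal_powD_sub => //; apply: IH => //; last by lia.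
by move=> y yxs; apply: xsI; rewrite inE yxs orbT.
Qed.

Lemma ideal_pow_gen xs N : ideal_pow (ideal_gen [set` xs]) N =
  ideal_gen [set mono xs a | a in [set a | size a = size xs /\ (N <= sumn a)%N]].
Proof.
apply/seteqP; split.
  elim: N => [|N IH].
    rewrite [X in _ `<=` X]ideal_eqT//; first exact: ideal_genP.
    by apply: sub_ideal_gen; exists (nseq (size xs) 0%N); rewrite ?mono0//= size_nseq.
  apply: ideal_mul_sub (ideal_genP _) _ => x y xI /IH.
  apply: mul_gen_sub xI; first exact: ideal_genP.
  move=> {x} {}y x /= /mono_var[e [se de <-]] [a [sa Na] <-].
  apply: sub_ideal_gen; exists (addv e a); last by rewrite monoD.
  by rewrite /= size_addv ?sumn_addv ?de ?se//; split=> //; lia.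
apply: ideal_gen_sub; first exact: ideal_powP.
move=> _ [a [sa Na] <-]; apply: mono_mem_pow => //; first exact: ideal_genP.
by move=> x xxs; apply: mem_set; exact: sub_ideal_gen.
Qed.

Lemma mono_outside_box xs B q a : is_ideal B -> (forall x, x \in xs -> B (x ^+ q)) ->
  size a = size xs -> ~~ all (fun t => t < q)%N a -> B (mono xs a).
Proof.
move=> iB; elim: xs a => [|x xs IH] [|t a] //= xsB [sa].
rewrite negb_and -leqNgt => /orP[qt|na].
  rewrite -(subnK qt) exprD mulrAC; apply: idealM => //.
  by apply: xsB; rewrite mem_head.
by apply: idealM => //; apply: IH => // y yxs; apply: xsB; rewrite inE yxs orbT.
Qed.

(** By the pigeonhole principle a monomial of degree above [n q] in [n] variables is
    divisible by the [q]-th power of one of them. *)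
Lemma ideal_pow_sub_box xs B q N : is_ideal B -> (forall x, x \in xs -> B (x ^+ q)) ->
  (size xs * q < N)%N -> ideal_pow (ideal_gen [set` xs]) N `<=` B.
Proof.
move=> iB xsB Nq; rewrite ideal_pow_gen; apply: ideal_gen_sub => // _ [a [sa Na] <-].
apply: (@mono_outside_box xs B q) => //; apply/negP => /leq_sumn_box; rewrite sa; lia.
Qed.

Definition above xs a : set A :=
  ideal_gen [set mono xs b | b in [set b | size b = size xs /\ exp_lt a b]].

(** The annihilator of the class of [x^a] modulo the larger monomials. *)
Definition lead_colon xs a : set A := colon (above xs a) (mono xs a).

Lemma lead_colon_ideal xs a : is_ideal (lead_colon xs a).
Proof. exact/ideal_colon/ideal_genP. Qed.

Lemma sub_lead_colon xs a : size a = size xs ->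
  ideal_gen [set` xs] `<=` lead_colon xs a.
Proof.
move=> sa; apply: ideal_gen_sub; first exact: lead_colon_ideal.
move=> x /= /mono_var[e [se de <-]]; rewrite /lead_colon/colon/= -monoD//.
apply: sub_ideal_gen; exists (addv e a) => //=.
by rewrite size_addv ?se// /exp_lt sumn_addv ?se// de ltnS leqnn.
Qed.

(** Multiplication by a monomial preserves the order of the exponents. *)
Lemma lead_colon_mono xs a c : size a = size xs -> size c = size xs ->
  lead_colon xs a `<=` lead_colon xs (addv a c).
Proof.
move=> sa sc z; rewrite /lead_colon/colon/= monoD// mulrA; move: (z * _) => {}z.
suff : above xs a `<=` colon (above xs (addv a c)) (mono xs c) by exact.
apply: ideal_gen_sub; first exact/ideal_colon/ideal_genP.
move=> _ [b [sb ab] <-]; rewrite /colon/= -monoD//.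
apply: sub_ideal_gen; exists (addv b c) => //=.
by rewrite size_addv ?sb//; split=> //; apply: exp_lt_addv => //; rewrite ?sa ?sb.
Qed.

Definition lead_length xs a := length_quot (lead_colon xs a).

Section Filtration.
Variables (xs : seq A) (L : nat).
Let I := ideal_gen [set` xs].
Hypothesis IL : has_length I setT L.
Let n := size xs.

Let iI : is_ideal I. Proof. exact: ideal_genP. Qed.

Lemma lead_lengthP a : size a = n -> has_length (lead_colon xs a) setT (lead_length xs a).
Proof.
move=> sa; have [k _ hk] := has_length_le (lead_colon_ideal xs a) (@subsetT _ _)
  (sub_lead_colon sa) (@subset_refl _ _) IL.
by rewrite /lead_length (length_quotE hk).
Qed.

Lemma lead_length_max a : size a = n -> (lead_length xs a <= L)%N.
Proof.
move=> sa; have [k kL hk] := has_length_le (lead_colon_ideal xs a) (@subsetT _ _)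
  (sub_lead_colon sa) (@subset_refl _ _) IL.
by rewrite /lead_length (length_quotE hk).
Qed.

Lemma lead_length_noninc a c : size a = n -> size c = n ->
  (lead_length xs (addv a c) <= lead_length xs a)%N.
Proof.
move=> sa sc; have [k kL hk] := has_length_le (lead_colon_ideal xs (addv a c))
  (@subsetT _ _) (lead_colon_mono sa sc) (@subset_refl _ _) (lead_lengthP sa).
by rewrite {1}/lead_length (length_quotE hk).
Qed.

Lemma has_length_step a : size a = n ->
  has_length (above xs a) (add_principal (above xs a) (mono xs a)) (lead_length xs a).
Proof.
by move=> sa; apply/has_length_colon; [exact: ideal_genP|exact: lead_lengthP].
Qed.

(** The layer [(I^N + B) / (I^(N+1) + B)] is filtered by adding the monomials of
    degree [N] one at a time, from the largest to the smallest. *)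
Lemma has_length_layer B N (d : seq nat -> nat) : is_ideal B ->
  (forall a, size a = n -> has_length (ideal_sum (above xs a) B)
     (ideal_sum (add_principal (above xs a) (mono xs a)) B) (d a)) ->
  has_length (ideal_sum (ideal_pow I N.+1) B) (ideal_sum (ideal_pow I N) B)
     (\sum_(a <- layer n N.+1 N) d a)%N.
Proof.
move=> iB dP.
(* The ideals of the filtration of this layer, indexed by the tails s of the
   increasing list s0 of the exponents of degree N. *)
pose gens (s : seq (seq nat)) : set A := ideal_gen
  [set mono xs b | b in [set b | size b = n /\ (b \in s) || (N < sumn b)%N]].
pose s0 : seq (seqlexi nat) := sort <=%O (layer n N.+1 N : seq (seqlexi nat)).
have mem_s0 b : (b \in s0) = (size b == n) && (sumn b == N).
  rewrite mem_sort mem_layer; congr (_ && _); case: eqP => [bN|]; rewrite ?andbF ?andbT//.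
  by rewrite sumn_all_lt ?bN.
have s0_sorted : sorted <%O s0.
  by rewrite sort_lt_sorted filter_uniq// box_uniq.
have -> : ideal_pow I N.+1 = gens [::] by rewrite ideal_pow_gen.
have -> : ideal_pow I N = gens s0.
  rewrite ideal_pow_gen; congr ideal_gen; congr image.
  by apply/seteqP; split=> b /= [sb]; rewrite mem_s0 sb eqxx (leq_eqVlt N) (eq_sym N).
have -> : (\sum_(a <- layer n N.+1 N) d a = \sum_(a <- s0) d a)%N.
  by apply: perm_big; rewrite perm_sym; apply/permPl/perm_sort.
have : exists s1 : seq (seqlexi nat), s1 ++ s0 = s0 by exists [::].
move: {1 3 4}s0 => s; elim: s => [_|a s IH [s1 s0E]].
  by rewrite big_nil; apply: has_length_id; apply: ideal_sumP => //; exact: ideal_genP.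
have [sa aN] : size a = n /\ sumn a = N.
  have : a \in s0 by rewrite -s0E mem_cat mem_head orbT.
  by rewrite mem_s0 => /andP[/eqP ? /eqP].
move: s0_sorted; rewrite lt_sorted_pairwise -s0E pairwise_cat /= => /and3P[/allrelP s1as _ /andP[/allP as_ _]].
have aboveE : above xs a = gens s.
  congr ideal_gen; congr image; apply/seteqP; split=> b /= [sb]; rewrite /exp_lt aN.
    case: ltngtP => //= [|bN]; first by rewrite orbT.
    move=> ab; split=> //; rewrite orbF.
    have : b \in s0 by rewrite mem_s0 sb bN !eqxx.
    rewrite -s0E mem_cat inE => /or3P[bs1|/eqP ba|//].
      have := s1as b a bs1; rewrite mem_head => /(_ isT) ba.
      by have := lt_trans ab ba; rewrite ltxx.
    by rewrite ba ltxx in ab.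
  case/orP => [bs|->//]; split=> //.
  have : b \in s0 by rewrite -s0E mem_cat inE bs !orbT.
  by rewrite mem_s0 => /andP[_ /eqP ->]; rewrite ltnn eqxx /=; exact: as_.
have consE : add_principal (above xs a) (mono xs a) = gens (a :: s).
  rewrite aboveE; apply/seteqP; split.
    apply: ideal_sum_sub; first exact: ideal_genP.
      apply: ideal_gen_le => _ [b [sb bs] <-]; exists b => //; split=> //.
      by rewrite inE; case/orP: bs => ->; rewrite !orbT.
    apply: principal_sub; first exact: ideal_genP.
    by apply: sub_ideal_gen; exists a => //; rewrite /= mem_head.
  apply: ideal_gen_sub; first exact/add_principalP/ideal_genP.
  move=> _ [b [sb] bs <-]; move: bs; rewrite inE -orbA => /orP[/eqP ->|bs].
    exact/add_principal_mem/ideal_genP.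
  by apply: (@sub_add_principal _ (gens s)); apply: sub_ideal_gen; exists b.
rewrite big_cons addnC -consE; apply: has_lengthD; last exact: dP.
- by apply: ideal_sumP => //; exact: ideal_genP.
- by apply: ideal_sumP => //; exact: ideal_genP.
- by apply: ideal_sumP => //; exact/add_principalP/ideal_genP.
- rewrite aboveE; apply: ideal_sumSS => //; apply: ideal_gen_le => _ [b [sb bs] <-].
  by exists b => //; split=> //; move: bs => /= ->; rewrite orbT.
- by apply: ideal_sumSS => //; exact: sub_add_principal.
- by rewrite aboveE; apply: IH; exists (rcons s1 a); rewrite cat_rcons.
Qed.

Lemma has_length_pow N q : (N <= q)%N ->
  has_length (ideal_pow I N) setT (\sum_(a <- box n q N) lead_length xs a)%N.
Proof.
move=> /big_box_wide ->; elim: N => [|N IH].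
  rewrite big1_seq; last by move=> a; rewrite mem_box ltn0 !andbF.
  exact/has_length_id/ideal_setT.
rewrite big_box_layer big_box_wide// addnC.
apply: (has_lengthD (ideal_powP _ _) (ideal_powP _ _) (@ideal_setT _)) IH => //.
  exact: ideal_pow_decS.
have := @has_length_layer _ N (lead_length xs) (ideal_set0 A).
rewrite !ideal_sum0; apply=> a sa; rewrite !ideal_sum0; exact: has_length_step.
Qed.

(** Modulo an ideal containing the [q]-th powers of the generators, the
    monomials outside of the box contribute nothing to the layers. *)
Lemma has_length_layer_box B q N : is_ideal B -> (forall x, x \in xs -> B (x ^+ q)) ->
  exists2 v, (v <= \sum_(a <- layer n q N) lead_length xs a)%N &
    has_length (ideal_sum (ideal_pow I N.+1) B) (ideal_sum (ideal_pow I N) B) v.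
Proof.
move=> iB xsB.
pose X a := ideal_sum (above xs a) B.
pose Y a := ideal_sum (add_principal (above xs a) (mono xs a)) B.
have XY a : size a = n -> exists2 k, (k <= lead_length xs a)%N & has_length (X a) (Y a) k.
  move=> sa; apply: has_length_addr; rewrite //.
  - exact: ideal_genP.
  - exact/add_principalP/ideal_genP.
  - exact: sub_add_principal.
  - exact: has_length_step.
pose d a := xget 0%N (has_length (X a) (Y a)).
have dP a : size a = n -> has_length (X a) (Y a) (d a).
  by move=> /XY[k _ hk]; rewrite /d; case: xgetP => // /(_ k).
exists (\sum_(a <- layer n N.+1 N) d a)%N; last exact: has_length_layer.
rewrite -(@big_layer_box n q N.+1)// [leqRHS]big_mkcond [leqRHS]big_seq [leqLHS]big_seq /=.
apply: leq_sum => a; rewrite mem_layer => /and3P[/eqP sa _ _].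
have [k kl hk] := XY a sa; case: ifPn => [_|na].
  by rewrite (max_chain_uniq (dP a sa) hk).
rewrite leqn0; apply/eqP; apply: max_chain_uniq (dP a sa) _.
have -> : Y a = X a; last by apply/has_length_id/ideal_sumP => //; exact: ideal_genP.
apply/seteqP; split; last by apply: ideal_sumSS => //; exact: sub_add_principal.
have iX : is_ideal (X a) by apply: ideal_sumP => //; exact: ideal_genP.
apply: ideal_sum_sub => //; last by apply: ideal_sumr; exact: ideal_genP.
apply: ideal_sum_sub => //; first exact: ideal_suml.
apply: principal_sub => //; apply: ideal_sumr; first exact: ideal_genP.
exact: mono_outside_box na.
Qed.

(** The filtration by the [I^N + B] grows at each layer by at most the contribution of
    the monomials in the box. *)
Lemma has_length_pow_box B q : is_ideal B -> (forall x, x \in xs -> B (x ^+ q)) ->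
  exists U : nat -> nat,
    [/\ forall N, has_length (ideal_sum (ideal_pow I N) B) setT (U N),
        U 0%N = 0%N &
        forall N, (U N.+1 <= U N + \sum_(a <- layer n q N) lead_length xs a)%N].
Proof.
move=> iB xsB.
have iIB N : is_ideal (ideal_sum (ideal_pow I N) B).
  by apply: ideal_sumP => //; exact: ideal_powP.
pose U N := length_quot (ideal_sum (ideal_pow I N) B).
have U0 : has_length (ideal_sum (ideal_pow I 0) B) setT 0.
  rewrite (_ : ideal_sum _ _ = setT); first exact/has_length_id/ideal_setT.
  by apply: ideal_eqT => //; exact: ideal_suml.
have US N u : has_length (ideal_sum (ideal_pow I N) B) setT u ->
    exists2 v, (v <= \sum_(a <- layer n q N) lead_length xs a)%N &
      has_length (ideal_sum (ideal_pow I N.+1) B) setT (u + v).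
  move=> hu; have [v vl hv] := has_length_layer_box N iB xsB; exists v => //.
  rewrite addnC; apply: has_lengthD hv hu => //; first exact: ideal_setT.
  by apply: ideal_sumSS => //; exact: ideal_pow_decS.
have UP N : has_length (ideal_sum (ideal_pow I N) B) setT (U N).
  rewrite /U; elim: N => [|N IH]; first by rewrite (length_quotE U0).
  by have [v _ hv] := US N _ IH; rewrite (length_quotE hv).
exists U; split=> //; first exact: length_quotE.
move=> N; have [v vl /length_quotE hv] := US N _ (UP N).
by rewrite {1}/U hv leq_add2l.
Qed.

End Filtration.
End Monomials.

(** * Sums of nonincreasing functions over boxes *)

Section Noninc.
Local Open Scope nat_scope.
Implicit Types (l : seq nat -> nat) (a c : seq nat).

Definition noninc n l := forall a c, size a = n -> size c = n -> l (addv a c) <= l a.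

Lemma addv0 a : addv a (nseq (size a) 0) = a.
Proof. by elim: a => //= x a ->; rewrite addn0. Qed.

Lemma noninc_slice n l t : noninc n.+1 l -> noninc n (fun a => l (t :: a)).
Proof.
move=> h a c sa sc; have := h (t :: a) (0 :: c).
by rewrite /= sa sc addn0; exact.
Qed.

Lemma noninc_cons n l t t' a : noninc n.+1 l -> size a = n -> t <= t' -> l (t' :: a) <= l (t :: a).
Proof.
move=> h sa tt'; have := h (t :: a) (t' - t :: nseq (size a) 0).
by rewrite /= subnKC// addv0 size_nseq sa; exact.
Qed.

(** A form of Dickson's lemma. The induction passes through the diagonal
    [(t, t, a)]: once it is stable from [t1] on, monotonicity makes [l] independent of
    the first two entries above [t1], and finitely many slices remain. *)
Lemma noninc_stable n l : noninc n.+1 l ->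
  exists t0, forall t a, size a = n -> t0 <= t -> l (t :: a) = l (t0 :: a).
Proof.
elim: n l => [|n IH] l hl.
  have e : exists v, `[< exists t, l [:: t] = v >] by exists (l [:: 0]); apply/asboolP; exists 0.
  case: (ex_minnP e) => v /asboolP[t0 t0v] vmin; exists t0 => t [|//] _ t0t.
  apply/eqP; rewrite eqn_leq (noninc_cons hl)//= t0v; apply: vmin.
  by apply/asboolP; exists t.
have [|t1 h1] := IH (fun s => l (head 0 s :: s)).
  move=> [//|x a] [//|y c] [sa] [sc]; have := hl (x :: x :: a) (y :: y :: c).
  by rewrite /= sa sc; exact.
have [T hT] : exists T, forall b t a, size a = n -> b < t1 -> T <= t ->
    l (t :: b :: a) = l (T :: b :: a).
  elim: (t1) => [|k [T hT]]; first by exists 0.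
  have [|T' hT'] := IH (fun s => l (head 0 s :: k :: behead s)).
    move=> [//|x a] [//|y c] [sa] [sc]; have := hl (x :: k :: a) (y :: 0 :: c).
    by rewrite /= addn0 sa sc; exact.
  exists (maxn T T') => b t a sa; rewrite ltnS leq_eqVlt => /orP[/eqP ->|bk]; rewrite geq_max => /andP[Tt T't].
    by rewrite (hT' t a)// (hT' (maxn T T') a)// leq_maxr.
  by rewrite (hT b t)// (hT b (maxn T T'))// leq_maxl.
exists (maxn T t1) => t [//|b a] [sa]; rewrite geq_max => /andP[Tt t1t].
case: (ltnP b t1) => bt1; first by rewrite (hT b t)// (hT b (maxn T t1))// leq_maxl.
suff hc s : t1 <= s -> l (s :: b :: a) = l (t1 :: t1 :: a) by rewrite !hc// leq_maxr.
move=> t1s; apply/eqP; rewrite eqn_leq; apply/andP; split.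
  apply: (@leq_trans (l (t1 :: b :: a))); first by apply: (noninc_cons hl) => //=; rewrite sa.
  exact: (noninc_cons (noninc_slice t1 hl)).
rewrite -(h1 (maxn s b) a sa) /=; last by rewrite leq_max t1s.
apply: (@leq_trans (l (s :: maxn s b :: a))).
  by apply: (noninc_cons hl) => /=; rewrite ?sa ?leq_maxl.
by apply: (noninc_cons (noninc_slice s hl)) => //; rewrite leq_maxr.
Qed.

Definition boxsum n l q N := \sum_(a <- box n q N) l a.

Lemma boxsum0 l q N : boxsum 0 l q N = if 0 < N then l [::] else 0.
Proof. by rewrite /boxsum /=; case: ifP; rewrite ?big_seq1 ?big_nil. Qed.

Lemma boxsumS n l q N :
  boxsum n.+1 l q N = \sum_(0 <= t < q) boxsum n (fun a => l (t :: a)) q (N - t).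
Proof. exact: big_boxS. Qed.

Lemma boxsum_ext n l l' q N : (forall a, size a = n -> l a = l' a) ->
  boxsum n l q N = boxsum n l' q N.
Proof. by move=> h; apply: eq_big_seq => a; rewrite mem_box => /andP[/eqP /h]. Qed.

Lemma boxsum_le n l l' q N : (forall a, size a = n -> l a <= l' a) ->
  boxsum n l q N <= boxsum n l' q N.
Proof.
move=> h; rewrite /boxsum !big_seq; apply: leq_sum => a.
by rewrite mem_box => /andP[/eqP /h].
Qed.

Lemma boxsum_mono n l q q' N N' : q <= q' -> N <= N' -> boxsum n l q N <= boxsum n l q' N'.
Proof.
move=> qq'; elim: n l N N' => [|n IH] l N N' NN'.
  by rewrite !boxsum0; case: (ltnP 0 N) => // N0; rewrite (leq_trans N0 NN').
rewrite !boxsumS (big_cat_nat (leq0n q) qq')/= -[leqLHS]addn0; apply: leq_add => //.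
by apply: leq_sum => t _; apply: IH; lia.
Qed.

Definition boxcount d q N := boxsum d (fun=> 1) q N.

Lemma boxcountS d q N : boxcount d.+1 q N = \sum_(0 <= t < q) boxcount d q (N - t).
Proof. exact: boxsumS. Qed.

Lemma boxcount_le d q N : boxcount d q N <= q ^ d.
Proof.
elim: d N => [|d IH] N; first by rewrite /boxcount boxsum0; case: ifP.
rewrite boxcountS expnS; apply: leq_trans (leq_sum _ (fun t _ => IH (N - t))) _.
by rewrite sum_nat_const_nat subn0.
Qed.

Lemma window_shift (f : nat -> nat) q N :
  \sum_(0 <= t < q) f (N - t) <= f N + \sum_(0 <= t < q) f (N.-1 - t).
Proof.
case: q => [|q]; first by rewrite !big_nil.
rewrite big_nat_recl// subn0 leq_add2l big_nat_recr//=.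
apply: leq_trans (leq_addr _ _); apply: leq_sum => t _.
by rewrite (_ : N - t.+1 = N.-1 - t)//; lia.
Qed.

(** A unit shift of [N] removes at most one slice of [q ^ d] points. *)
Lemma boxcount_shift d q N t : boxcount d.+1 q N <= boxcount d.+1 q (N - t) + t * q ^ d.
Proof.
elim: t => [|t IH]; first by rewrite subn0 addn0.
apply: leq_trans IH _; rewrite mulSn addnCA [leqRHS]addnA leq_add2r subnS.
rewrite !boxcountS; apply: leq_trans (window_shift _ _ _) _.
by rewrite leq_add2r boxcount_le.
Qed.

End Noninc.

Section Asymptotics.
Variable R : realFieldType.
Implicit Types (f g : nat -> nat -> R) (d q N t : nat).

(** Functions of size [O(q ^ (d - 1))]; in dimension [0], where this exponent is
    negative, the bound is required after summation over a window of length
    [q]. *)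
Definition negligible d f := exists C : R, forall q N, (0 < q)%N ->
  if d is k.+1 then `|f q N| <= C * q%:R ^+ k
  else \sum_(0 <= t < q) `|f q (N - t)%N| <= C.

Lemma negligible_ext d f g : (forall q N, (0 < q)%N -> f q N = g q N) ->
  negligible d f -> negligible d g.
Proof.
move=> fg [C hC]; exists C => q N q0; have := hC q N q0.
case: d {hC} => [|d]; last by rewrite fg.
by under eq_bigr do rewrite fg//.
Qed.

Lemma negligibleD d f g : negligible d f -> negligible d g ->
  negligible d (fun q N => f q N + g q N).
Proof.
move=> [C hC] [D hD]; exists (C + D) => q N q0; have {hC} := hC q N q0; have {hD} := hD q N q0.
case: d => [|d] h1 h2.
  apply: le_trans (lerD h2 h1); rewrite -big_split /=.
  by apply: ler_sum => t _; exact: ler_normD.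
by rewrite mulrDl; apply: le_trans (ler_normD _ _) (lerD h2 h1).
Qed.

Lemma negligibleZ d f c : negligible d f -> negligible d (fun q N => c * f q N).
Proof.
move=> [C hC]; exists (`|c| * C) => q N q0; have {hC} := hC q N q0.
case: d => [|d] h.
  under eq_bigr do rewrite normrM.
  by rewrite -mulr_sumr ler_wpM2l.
by rewrite normrM -mulrA ler_wpM2l.
Qed.

Lemma negligible_shift d f t : negligible d f -> negligible d (fun q N => f q (N - t)%N).
Proof.
move=> [C hC]; exists C => q N q0; have {hC} := hC q (N - t)%N q0.
by case: d => // h; under eq_bigr do rewrite subnAC.
Qed.

Lemma negligible_window d f : negligible d f ->
  negligible d.+1 (fun q N => \sum_(0 <= t < q) f q (N - t)%N).
Proof.
move=> [C hC]; exists C => q N q0.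
case: d hC => [|d] hC; first by rewrite expr0 mulr1; apply: le_trans (ler_norm_sum _ _ _) (hC q N q0).
apply: le_trans (ler_norm_sum _ _ _) _.
apply: le_trans (ler_sum _ (fun t _ => hC q (N - t)%N q0)) _.
by rewrite sumr_const_nat subn0 exprS -mulrnAr -mulr_natl.
Qed.

Lemma negligible_finite d f q0 C : (forall q N, (0 < q)%N -> (q < q0)%N -> `|f q N| <= C) ->
  (forall q N, (q0 <= q)%N -> f q N = 0) -> negligible d f.
Proof.
move=> fC f0; have C0 : 0 <= Num.max C 0 by rewrite le_max lexx orbT.
have fC' q N : (0 < q)%N -> `|f q N| <= Num.max C 0.
  move=> q1; case: (ltnP q q0) => qq0; last by rewrite f0// normr0.
  by rewrite le_max fC.
case: d => [|d].
  exists (Num.max C 0 * q0%:R) => q N q1.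
  case: (ltnP q q0) => qq0; last first.
    by rewrite big1 ?mulr_ge0// => t _; rewrite f0 ?normr0.
  apply: le_trans (ler_sum _ (fun t _ => fC' q (N - t)%N q1)) _.
  by rewrite sumr_const_nat subn0 -[leLHS]mulr_natr ler_wpM2l// ler_nat ltnW.
exists (Num.max C 0) => q N q1; apply: le_trans (fC' q N q1) _.
by rewrite ler_peMr// exprn_ege1// ler1n.
Qed.

(** [f] counts, up to lower order, [E] truncated [d]-dimensional cubes. *)
Definition asymptotic d f := exists E : R,
  negligible d (fun q N => f q N - E * (boxcount d q N)%:R).

Lemma asymptotic_ext d f g : (forall q N, (0 < q)%N -> f q N = g q N) ->
  asymptotic d f -> asymptotic d g.
Proof.
by move=> fg [E hE]; exists E; apply: negligible_ext hE => q N q0; rewrite fg.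
Qed.

Lemma asymptotic_negligible d f : negligible d f -> asymptotic d f.
Proof.
by move=> hf; exists 0; apply: negligible_ext hf => q N q0; rewrite mul0r subr0.
Qed.

Lemma asymptoticD d f g : asymptotic d f -> asymptotic d g ->
  asymptotic d (fun q N => f q N + g q N).
Proof.
move=> [E hE] [F hF]; exists (E + F); apply: negligible_ext (negligibleD hE hF) => q N q0.
by ring.
Qed.

Lemma asymptotic_window d f : asymptotic d f ->
  asymptotic d.+1 (fun q N => \sum_(0 <= t < q) f q (N - t)%N).
Proof.
move=> [E hE]; exists E; apply: negligible_ext (negligible_window hE) => q N q0 /=.
by rewrite boxcountS natr_sum mulr_sumr -sumrB.
Qed.

Lemma negligible_boxcount_shift d t :
  negligible d (fun q N => (boxcount d q N)%:R - (boxcount d q (N - t)%N)%:R).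
Proof.
have mono d' q N : (boxcount d' q (N - t) <= boxcount d' q N)%N.
  by apply: boxsum_mono => //; exact: leq_subr.
have normE d' q N : `|(boxcount d' q N)%:R - (boxcount d' q (N - t)%N)%:R| =
    (boxcount d' q N)%:R - (boxcount d' q (N - t)%N)%:R :> R.
  by rewrite ger0_norm// subr_ge0 ler_nat.
exists t%:R => q N q0; case: d => [|d].
  under eq_bigr => u _ do rewrite normE (subnAC N u t).
  rewrite sumrB -!natr_sum -!boxcountS lerBlDl -natrD ler_nat.
  by have := boxcount_shift 0 q N t; rewrite expn0 muln1.
by rewrite normE lerBlDl -natrX -natrM -natrD ler_nat boxcount_shift.
Qed.

Lemma asymptotic_shift d f t : asymptotic d f -> asymptotic d (fun q N => f q (N - t)%N).
Proof.
move=> [E hE]; exists E.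
apply: negligible_ext
  (negligibleD (negligible_shift t hE) (negligibleZ (- E) (negligible_boxcount_shift d t))).
by move=> q N q0; ring.
Qed.

Lemma asymptotic_sum d T (f : nat -> nat -> nat -> R) : (forall t, asymptotic d (f t)) ->
  asymptotic d (fun q N => \sum_(0 <= t < T) f t q N).
Proof.
move=> h; elim: T => [|T IH].
  apply: asymptotic_negligible; apply: (@negligible_finite _ _ 0%N 0) => // q N _.
  by rewrite big_nil.
apply: asymptotic_ext (asymptoticD IH (h T)) => q N q0.
by rewrite big_nat_recr.
Qed.

(** By induction on the number [n] of variables. The slices of [l] along the first
    variable are eventually equal to one slice [H]. Since the sum contains [q] copies of
    [H], the sums of [H] grow with exponent at most [d - 1], and these copies contribute
    the window sum of a [(d - 1)]-dimensional asymptotic. The finitely many remaining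
    slices are [d]-dimensional, and [H] is negligible against them. *)
Lemma boxsum_asymptotic n d (l : seq nat -> nat) C : noninc n l ->
  (forall q N, (0 < q)%N -> (boxsum n l q N <= C * q ^ d)%N) ->
  asymptotic d (fun q N => (boxsum n l q N)%:R).
Proof.
elim: n d l C => [|n IH] d l C hl hC.
  case: d hC => [|d] hC.
    exists (l [::])%:R; exists 0 => q N q0; rewrite big1// => t _.
    by rewrite /boxcount !boxsum0; case: ifP => _; rewrite ?mulr1 ?mulr0 subrr normr0.
  apply: asymptotic_negligible; exists (l [::])%:R => q N q0.
  rewrite normr_nat; apply: (@le_trans _ _ (l [::])%:R).
    by rewrite boxsum0; case: ifP.
  by rewrite ler_peMr// exprn_ege1// ler1n.
have [t0 ht0] := noninc_stable hl.
pose G t q N := boxsum n (fun a => l (t :: a)) q N.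
pose H := G t0.
have Gle t q N : (0 < q)%N -> (G t q N <= boxsum n.+1 l q N)%N.
  move=> q0; rewrite boxsumS big_ltn// subn0; apply: leq_trans (leq_addr _ _).
  by apply: boxsum_le => a sa; exact: (noninc_cons hl sa (leq0n t)).
have HG t q N : (H q N <= G t q N)%N.
  apply: boxsum_le => a sa; case: (leqP t t0) => h; first exact: noninc_cons hl sa h.
  by rewrite (ht0 t a sa) ?(ltnW h).
have GH t q N : (t0 <= t)%N -> G t q N = H q N.
  by move=> h; apply: boxsum_ext => a sa; exact: ht0.
have qH q N : (0 < q)%N -> (q * H q N <= C * q ^ d)%N.
  move=> q0; apply: leq_trans (hC q (N + q)%N q0).
  rewrite boxsumS -[leqLHS](_ : \sum_(0 <= t < q) H q N = _)%N; last first.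
    by rewrite sum_nat_const_nat subn0.
  rewrite !big_nat; apply: leq_sum => t /andP[_ tq]; apply: leq_trans (HG t _ _) _.
  by apply: boxsum_mono => //; lia.
have [nH aH] : negligible d (fun q N => (H q N)%:R) /\
    asymptotic d (fun q N => \sum_(0 <= t < q) (H q (N - t)%N)%:R).
  case: d qH {hC} => [|k] qH.
    have H0 q N : H q N = 0%N.
      have CQ : (C < maxn q C.+1)%N by rewrite leq_maxr.
      have hq : (H q N <= H (maxn q C.+1) N)%N by apply: boxsum_mono; rewrite ?leq_maxl.
      have := qH (maxn q C.+1) N (leq_ltn_trans (leq0n C) CQ); rewrite expn0 muln1 => hC.
      apply/eqP; rewrite -leqn0; apply: leq_trans hq _; rewrite leqNgt; apply/negP => hp.
      by have := leq_pmulr (maxn q C.+1) hp => /leq_trans /(_ hC); rewrite leqNgt CQ.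
    split; first by apply: (@negligible_finite _ _ 0%N 0) => // q N _; rewrite H0.
    apply: asymptotic_negligible; apply: (@negligible_finite _ _ 0%N 0) => // q N _.
    by rewrite big1// => t _; rewrite H0.
  have Hk q N : (0 < q)%N -> (H q N <= C * q ^ k)%N.
    by move=> q0; have := qH q N q0; rewrite expnS mulnCA leq_pmul2l.
  split; first by exists C%:R => q N q0; rewrite normr_nat -natrX -natrM ler_nat Hk.
  apply: (@asymptotic_window k (fun q N => (H q N)%:R)).
  exact: (IH k _ C (noninc_slice t0 hl) Hk).
pose D t q N : R := (G t q N)%:R - (H q N)%:R.
have D0 t q N : (t0 <= t)%N -> D t q N = 0 by move=> h; rewrite /D GH// subrr.
have aD t : asymptotic d (D t).
  apply: asymptotic_ext (asymptoticD (IH d _ C (noninc_slice t hl) _)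
    (asymptotic_negligible (negligibleZ (-1) nH))) => [q N q0|q N q0]; first by rewrite mulN1r.
  exact: leq_trans (Gle t q N q0) (hC q N q0).
(* For q below t0 the slices of index at least q do not occur in the box. *)
have nD : negligible d (fun q N => \sum_(q <= t < t0) D t q (N - t)%N).
  apply: (@negligible_finite _ _ t0 (t0 * (C * t0 ^ d))%:R) => [q N q0 qt0|q N qt0].
    apply: le_trans (ler_norm_sum _ _ _) _.
    apply: (@le_trans _ _ (\sum_(q <= t < t0) (C * t0 ^ d)%:R)).
      apply: ler_sum => t _; rewrite ger0_norm ?subr_ge0 ?ler_nat// lerBlDr -natrD ler_nat.
      apply: leq_trans (leq_addr _ _); apply: leq_trans (Gle t q _ q0) _.
      apply: leq_trans (hC _ _ q0) _; rewrite leq_mul2l; apply/orP; right.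
      by case: (d) => [//|k]; rewrite leq_exp2r// ltnW.
    by rewrite -natr_sum ler_nat sum_nat_const_nat leq_mul2r leq_subr orbT.
  by rewrite big_geq.
apply: asymptotic_ext (asymptoticD (asymptoticD aH
  (asymptotic_sum t0 (fun t => asymptotic_shift t (aD t))))
  (asymptotic_negligible (negligibleZ (-1) nD))) => q N q0.
rewrite mulN1r boxsumS natr_sum -addrA.
have -> : \sum_(0 <= t < t0) D t q (N - t)%N =
    \sum_(0 <= t < q) D t q (N - t)%N + \sum_(q <= t < t0) D t q (N - t)%N.
  case: (leqP q t0) => h; first by rewrite -big_cat_nat.
  rewrite [X in _ = _ + X]big_geq ?addr0; last exact: ltnW.
  rewrite [RHS](@big_cat_nat _ _ _ t0) ?(ltnW h)//= [X in _ + X]big_nat_cond [X in _ + X]big1 ?addr0//.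
  by move=> t; rewrite andbT => /andP[h' _]; exact: D0.
by rewrite addrK -big_split /=; apply: eq_bigr => t _; rewrite /D addrC subrK.
Qed.

End Asymptotics.

(** * Truncated cubes and their volumes *)

Section Simplex.

(** The number of exponent vectors in [d] variables of degree below [N]; for [N = 0]
    and [d = 0] the binomial coefficient would give [1]. *)
Definition simplex_count d N : nat := if N is M.+1 then 'C(M + d, d) else 0%N.

Lemma simplex_countS d N :
  simplex_count d.+1 N.+1 = (simplex_count d.+1 N + simplex_count d N.+1)%N.
Proof.
case: N => [|M] /=; first by rewrite !add0n !binn.
by rewrite [in LHS]addSn binS addSnnS.
Qed.

Lemma simplex_count_window d q N :
  (\sum_(0 <= t < q) simplex_count d (N - t) + simplex_count d.+1 (N - q) =
   simplex_count d.+1 N)%N.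
Proof.
elim: q => [|q IH]; first by rewrite big_nil subn0.
rewrite big_nat_recr//= -[RHS]IH -addnA; congr (_ + _)%N.
rewrite subnS; case: (N - q)%N => [|M]; last by rewrite simplex_countS addnC.
by case: (d).
Qed.

Lemma simplex_count_bounds d N : (0 < d)%N ->
  (N ^ d <= d`! * simplex_count d N <= (N + d) ^ d)%N.
Proof.
move=> d0; case: N => [|M]; first by rewrite exp0n// muln0.
rewrite /= mulnC bin_ffact {d0}; elim: d => [//|d IH].
rewrite addnS ffactSS !expnS; case/andP: IH => h1 h2; apply/andP; split.
  by apply: leq_mul => //; rewrite ltnS leq_addr.
apply: leq_mul; first by lia.
apply: leq_trans h2 _; case: (d) => // k.
by rewrite leq_exp2r// !addSn !addnS.
Qed.

Lemma boxcount_full d q N : (0 < q)%N -> (d * q < N + d)%N -> boxcount d q N = (q ^ d)%N.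
Proof.
move=> q0; elim: d N => [|d IH] N h.
  by rewrite /boxcount boxsum0; move: h; rewrite mul0n addn0 => ->.
rewrite boxcountS expnS -[RHS](_ : \sum_(0 <= t < q) q ^ d = _)%N; last first.
  by rewrite sum_nat_const_nat subn0.
rewrite !big_nat; apply: eq_bigr => t /andP[_ tq]; apply: IH; move: h; rewrite mulSn; lia.
Qed.

Variable R : comNzRingType.

Lemma sum_binomial_pascal (g : nat -> R) d :
  \sum_(i < d.+1) (-1) ^+ i * 'C(d, i)%:R * (g i - g i.+1) =
  \sum_(i < d.+2) (-1) ^+ i * 'C(d.+1, i)%:R * g i.
Proof.
rewrite [RHS]big_ord_recl /= expr0 bin0 !mul1r.
under eq_bigr do rewrite mulrBr.
rewrite sumrB.
have -> : \sum_(i < d.+1) (-1) ^+ i * 'C(d, i)%:R * g i =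
    \sum_(i < d.+2) (-1) ^+ i * 'C(d, i)%:R * g i.
  by rewrite [RHS]big_ord_recr /= bin_small// mulr0 mul0r addr0.
rewrite big_ord_recl /= expr0 bin0 !mul1r -addrA -sumrB; congr (_ + _).
apply: eq_bigr => i _; rewrite /bump /= add1n exprS binS natrD; ring.
Qed.

(** Inclusion-exclusion over the set of coordinates that are at least [q]. *)
Lemma boxcount_simplex d q N :
  (boxcount d q N)%:R =
  \sum_(i < d.+1) (-1) ^+ i * 'C(d, i)%:R * (simplex_count d (N - i * q))%:R :> R.
Proof.
elim: d N => [|d IH] N.
  rewrite big_ord1 mul0n subn0 bin0 expr0 !mul1r /boxcount boxsum0.
  by case: N => // M; rewrite /= bin0.
rewrite boxcountS natr_sum; under eq_bigr do rewrite IH.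
rewrite exchange_big /= -(sum_binomial_pascal (fun i => (simplex_count d.+1 (N - i * q))%:R)).
apply: eq_bigr => i _; rewrite -mulr_sumr; congr (_ * _).
have := simplex_count_window d q (N - i * q)%N; rewrite -subnDA -mulSnr => <-.
by rewrite natrD addrK natr_sum; apply: eq_bigr => t _; rewrite subnAC.
Qed.

End Simplex.

Section Volume.
Variable K : realType.
Implicit Types (s : K) (u v : nat -> K).

Lemma cvg_natV : (fun n : nat => n%:R^-1 : K) @ \oo --> (0 : K).
Proof. by rewrite -(cvg_shiftS (fun n : nat => n%:R^-1 : K)); exact: cvg_harmonic. Qed.

Lemma cvg_exprn u (l : K) d : u @ \oo --> l -> (fun n => u n ^+ d) @ \oo --> l ^+ d.
Proof. by move=> ul; exact: (cvg_comp u (fun x => x ^+ d) ul (@exprn_continuous K d l)). Qed.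

Lemma cvg_sum_ord m (f : nat -> nat -> K) (l : nat -> K) :
  (forall i, f i @ \oo --> l i) ->
  (fun n => \sum_(i < m) f i n) @ \oo --> \sum_(i < m) l i.
Proof.
move=> h; elim: m => [|m IH].
  rewrite big_ord0; under eq_fun do rewrite big_ord0; exact: cvg_cst.
rewrite big_ord_recr /=; under eq_fun do rewrite big_ord_recr /=.
by apply: cvgD.
Qed.

Lemma near_pos (P : nat -> Prop) : (forall n, (0 < n)%N -> P n) -> \forall n \near \oo, P n.
Proof. by move=> h; exists 1%N => // n /h. Qed.

(** The exponent [`|Num.ceil x|] as it occurs in [h_mult]. *)
Definition ceiln (x : K) : nat := `|Num.ceil x|%N.

Lemma ceiln_itv (x : K) : 0 <= x -> x <= (ceiln x)%:R < x + 1.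
Proof.
move=> x0; have c0 : 0 <= Num.ceil x by rewrite ceil_ge0; apply: lt_le_trans x0; rewrite ltrN10.
rewrite /ceiln natr_absz ger0_norm//; have /andP[h1 h2] := ceil_itv x.
by rewrite h2 /= -ltrBlDr; move: h1; rewrite intrB.
Qed.

Lemma ceiln_nat n : ceiln n%:R = n.
Proof.
have /andP[] := ceiln_itv (ler0n K n); rewrite ler_nat natr1 ltr_nat ltnS => h1 h2.
by apply/eqP; rewrite eqn_leq h1 h2.
Qed.

Lemma ceiln_le (x y : K) : 0 <= x -> x <= y -> (ceiln x <= ceiln y)%N.
Proof.
move=> x0 xy; have /andP[_ h1] := ceiln_itv x0.
have /andP[h2 _] := ceiln_itv (le_trans x0 xy).
by rewrite -ltnS -(ltr_nat K) -natr1; apply: lt_le_trans h1 _; rewrite lerD2r (le_trans xy).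
Qed.

Lemma cvg_simplex_count d (N : nat -> nat) (y : K) : (0 < d)%N -> 0 <= y ->
  (fun n => (N n)%:R / n%:R) @ \oo --> y ->
  (fun n => (simplex_count d (N n))%:R / n%:R ^+ d) @ \oo --> y ^+ d / (d`!)%:R.
Proof.
move=> d0 y0 Ny.
have f0 : (d`!)%:R != 0 :> K by rewrite pnatr_eq0 -lt0n fact_gt0.
have lower : (fun n => ((N n)%:R / n%:R) ^+ d / (d`!)%:R : K) @ \oo --> y ^+ d / (d`!)%:R.
  by apply: cvgM; [exact: cvg_exprn|exact: cvg_cst].
have upper : (fun n => ((N n)%:R / n%:R + d%:R * n%:R^-1) ^+ d / (d`!)%:R : K) @ \oo -->
    (y + d%:R * 0) ^+ d / (d`!)%:R.
  apply: cvgM; last exact: cvg_cst.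
  by apply: cvg_exprn; apply: cvgD => //; apply: cvgM; [exact: cvg_cst|exact: cvg_natV].
rewrite mulr0 addr0 in upper.
apply: squeeze_cvgr lower upper; apply: near_pos => n n0.
have np : 0 < n%:R ^+ d :> K by rewrite exprn_gt0// ltr0n.
have /andP[h1 h2] := simplex_count_bounds (N n) d0.
apply/andP; split.
  rewrite expr_div_n mulrAC ler_pM2r ?invr_gt0// ler_pdivrMr ?ltr0n ?fact_gt0//.
  by rewrite [leRHS]mulrC -natrX -natrM ler_nat.
rewrite -mulrDl expr_div_n [leRHS]mulrAC ler_pM2r ?invr_gt0// ler_pdivlMr ?ltr0n ?fact_gt0//.
by rewrite mulrC -natrD -natrX -natrM ler_nat.
Qed.

Lemma cvg_ceiln_sub s i : 0 <= s ->
  (fun n => (ceiln (s * n%:R) - i * n)%:R / n%:R) @ \oo --> Num.max (s - i%:R) 0.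
Proof.
move=> s0.
have upper : (fun n : nat => Num.max (s - i%:R) 0 + n%:R^-1 : K) @ \oo --> Num.max (s - i%:R) 0 + 0.
  by apply: cvgD; [exact: cvg_cst|exact: cvg_natV].
rewrite addr0 in upper.
apply: squeeze_cvgr (cvg_cst _) upper; apply: near_pos => n n0.
have np : 0 < n%:R :> K by rewrite ltr0n.
have /andP[h1 h2] := ceiln_itv (mulr_ge0 s0 (ltW np)).
have hle : 0 <= Num.max (s - i%:R) 0 by rewrite le_max lexx orbT.
rewrite ler_pdivlMr// ler_pdivrMr// mulrDl mulVf ?gt_eqF// maxr_pMl ?(ltW np)// mul0r mulrBl.
apply/andP; split.
  rewrite ge_max ler0n andbT.
  case: (leqP (i * n) (ceiln (s * n%:R))) => h; first by rewrite natrB// natrM lerD2r.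
  rewrite (eqP (_ : (_ - _ == 0)%N)) ?subn_eq0 ?(ltnW h)// subr_le0 -natrM.
  by apply: le_trans h1 _; rewrite ler_nat ltnW.
case: (leqP (i * n) (ceiln (s * n%:R))) => h.
  rewrite natrB// natrM -lerBlDr lerBlDr; apply: (@le_trans _ _ (s * n%:R + 1 - i%:R * n%:R)).
    by rewrite lerD2r ltW.
  by rewrite addrAC lerD2r le_max lexx.
by rewrite (eqP (_ : (_ - _ == 0)%N)) ?subn_eq0 ?(ltnW h)// addr_ge0// le_max lexx orbT.
Qed.

(** Replacing [s - i] by its positive part turns [H_norm] into a sum of fixed length:
    the summands with [i > s] vanish, and so do those with [i > d]. *)
Lemma H_normE d s : (0 < d)%N -> 0 <= s -> H_norm d s =
  \sum_(i < d.+1) (-1) ^+ i * 'C(d, i)%:R * (Num.max (s - i%:R) 0 ^+ d / (d`!)%:R).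
Proof.
move=> d0 s0; pose F i : K := (-1) ^+ i * 'C(d, i)%:R * (Num.max (s - i%:R) 0 ^+ d / (d`!)%:R).
have widen a b : (a <= b)%N -> (forall i, (a <= i)%N -> F i = 0) ->
    \sum_(0 <= i < b) F i = \sum_(0 <= i < a) F i.
  move=> ab Fa; rewrite (big_cat_nat (leq0n a) ab) /= [X in _ + X]big_nat_cond.
  by rewrite [X in _ + X]big1 ?addr0// => i; rewrite andbT => /andP[ai _]; exact: Fa.
have /andP[t1 t2] := truncn_itv s0.
transitivity (\sum_(0 <= i < (Num.truncn s).+1) F i).
  rewrite /H_norm !big_nat; apply: eq_bigr => i; rewrite ltnS => /andP[_ it].
  rewrite /F max_l; first by ring.
  by rewrite subr_ge0; apply: le_trans t1; rewrite ler_nat.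
rewrite -(big_mkord xpredT F) -(@widen _ (maxn (Num.truncn s).+1 d.+1)) ?leq_maxl//; last first.
  move=> i it; rewrite /F max_r; first by rewrite expr0n gtn_eqF// mul0r mulr0.
  by rewrite subr_le0; apply: le_trans (ltW t2) _; rewrite ler_nat.
by apply: widen; [exact: leq_maxr|move=> i di; rewrite /F bin_small// mulr0 mul0r].
Qed.

(** [H_norm d s] is the volume of the part of the unit cube where the sum of the
    coordinates is at most [s]. *)
Lemma cvg_boxcount d s : (0 < d)%N -> 0 < s ->
  (fun n => (boxcount d n (ceiln (s * n%:R)))%:R / n%:R ^+ d) @ \oo --> H_norm d s.
Proof.
move=> d0 s0; rewrite H_normE ?ltW//.
rewrite (_ : (fun n => _) = fun n => \sum_(i < d.+1) (-1) ^+ i * 'C(d, i)%:R *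
    ((simplex_count d (ceiln (s * n%:R) - i * n))%:R / n%:R ^+ d)); last first.
  apply/funext => n; rewrite boxcount_simplex mulr_suml.
  by apply: eq_bigr => i _; rewrite mulrA.
apply: (cvg_sum_ord (f := fun i n => (-1) ^+ i * 'C(d, i)%:R *
    ((simplex_count d (ceiln (s * n%:R) - i * n))%:R / n%:R ^+ d))
  (l := fun i => (-1) ^+ i * 'C(d, i)%:R * (Num.max (s - i%:R) 0 ^+ d / (d`!)%:R))) => i.
apply: cvgM; first exact: cvg_cst.
apply: cvg_simplex_count => //; first by rewrite le_max lexx orbT.
exact: cvg_ceiln_sub (ltW s0).
Qed.

Lemma H_norm1 d : (0 < d)%N -> H_norm d (1 : K) = (d`!)%:R^-1.
Proof.
move=> d0; rewrite /H_norm truncn1 !big_nat_recr//= big_nil.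
by rewrite subrr expr0n gtn_eqF// mulr0 addr0 add0r subr0 expr1n bin0 expr0 !mulr1 mul1r.
Qed.

(** For [s >= d] the truncation removes nothing from the cube. *)
Lemma H_norm_large d k : (0 < d)%N -> (d <= k)%N -> H_norm d (k%:R : K) = 1.
Proof.
move=> d0 dk; have k0 : 0 < k%:R :> K by rewrite ltr0n; exact: leq_trans dk.
have := cvg_boxcount d0 k0; set u := (fun n => _) => hu.
have : u @ \oo --> (1 : K).
  apply: cvg_near_cst; apply: near_pos => n n0.
  rewrite /u boxcount_full//; first by rewrite natrX divff// expf_eq0 pnatr_eq0 gtn_eqF ?andbF.
  rewrite -natrM ceiln_nat; apply: (@leq_ltn_trans (k * n)%N).
    by rewrite leq_mul2r dk orbT.
  by rewrite -[X in (X < _)%N]addn0 ltn_add2l.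
by move=> h1; exact: (cvg_unique _ hu h1).
Qed.

Lemma H_norm_gt0 d s : (0 < d)%N -> 0 < s -> 0 < H_norm d s.
Proof.
move=> d0 s0; case: (ltP s 1) => s1.
  have t0 : Num.truncn s = 0%N by apply: truncn_def; rewrite ltW.
  rewrite /H_norm t0 big_nat1 bin0 expr0 subr0 mulr1 mul1r.
  by rewrite mulr_gt0 ?exprn_gt0// invr_gt0 ltr0n fact_gt0.
apply: (@lt_le_trans _ _ (H_norm d 1)); first by rewrite H_norm1// invr_gt0 ltr0n fact_gt0.
apply: (ler_cvg_to (cvg_boxcount d0 (ltr01 : 0 < 1 :> K)) (cvg_boxcount d0 s0)).
apply: near_pos => n n0; rewrite ler_pM2r ?invr_gt0 ?exprn_gt0 ?ltr0n//.
rewrite ler_nat; apply: boxsum_mono => //; apply: ceiln_le.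
  by rewrite mul1r.
by rewrite ler_wpM2r.
Qed.

End Volume.

(** * Primes and systems of parameters *)

Section Primes.
Variable A : comNzRingType.
Implicit Types (I J P Q m : set A) (Ps : seq (set A)) (x y : A).

Lemma proper_idealP I : is_proper_ideal I <-> is_ideal I /\ ~ I 1.
Proof.
split=> [[I0 I1 IL]|[iI I1]].
  split; last by move/mem_set; exact/negP.
  by split=> //= a x y xI yI; exact: IL.
split; first by apply: mem_set; exact: ideal0.
  by apply/negP => /set_mem.
move=> a x y /set_mem Ix /set_mem Iy; apply: mem_set.
by apply: idealD => //; exact: idealM.
Qed.

Lemma prime_is_ideal P : is_prime_ideal P -> is_ideal P.
Proof. by case=> /proper_idealP[]. Qed.

Lemma prime_mul P x y : is_prime_ideal P -> P (x * y) -> P x \/ P y.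
Proof.
by case=> _ h Pxy; have /orP[/set_mem|/set_mem] := h x y (mem_set Pxy); [left|right].
Qed.

Lemma prime_proper P : is_prime_ideal P -> ~ P 1.
Proof. by case=> /proper_idealP[]. Qed.

Definition ideal_prod Ps : set A := foldr (@ideal_mul A) setT Ps.

Lemma ideal_prod_sub Ps P : (forall Q, Q \in Ps -> is_ideal Q) -> P \in Ps ->
  ideal_prod Ps `<=` P.
Proof.
elim: Ps => [//|Q Ps IH] iPs; have iQ : is_ideal Q by apply: iPs; rewrite mem_head.
rewrite inE => /orP[/eqP ->|PPs].
  by apply: ideal_mul_sub => // x y Qx _; exact: idealMr.
have iP : is_ideal P by apply: iPs; rewrite inE PPs orbT.
apply: ideal_mul_sub => // x y _ Py; apply: idealM => //; apply: IH Py => //.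
by move=> R RPs; apply: iPs; rewrite inE RPs orbT.
Qed.

Lemma prime_not_sub_prod Q Ps : is_prime_ideal Q ->
  (forall P, P \in Ps -> ~ P `<=` Q) -> exists2 y, ideal_prod Ps y & ~ Q y.
Proof.
move=> pQ; elim: Ps => [|P Ps IH] h; first by exists 1 => //; exact: prime_proper.
have [|y Py Qy] := IH; first by move=> R RPs; apply: h; rewrite inE RPs orbT.
have /existsNP[x /not_implyP[Px Qx]] := h P (mem_head _ _).
by exists (x * y); [exact: ideal_mul_mem|case/(prime_mul pQ)].
Qed.

(** Prime avoidance. If [x] avoids all primes but [Q], and [x] is in [Q], then add to [x]
    an element of all the other primes that is not in [Q]. *)
Lemma prime_avoidance m Ps : is_ideal m ->
  (forall P, P \in Ps -> is_prime_ideal P /\ ~ m `<=` P) ->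
  exists2 x, m x & forall P, P \in Ps -> ~ P x.
Proof.
move=> im; have [k] := ubnP (size Ps); elim: k Ps => // k IH [|Q Ps] /=.
  by move=> _ _; exists 0 => //; exact: ideal0.
rewrite ltnS => szPs h; have [pQ mQ] := h Q (mem_head _ _).
(* Avoiding Q is enough to avoid the primes that it contains. *)
pose Rs := [seq P <- Ps | ~~ `[< P `<=` Q >]].
have RsP P : P \in Rs -> is_prime_ideal P /\ ~ m `<=` P.
  by rewrite mem_filter => /andP[_ PPs]; apply: h; rewrite inE PPs orbT.
have [|x mx xRs] := IH Rs _ RsP.
  by apply: leq_ltn_trans szPs; rewrite size_filter count_size.
suff [z mz [zQ zRs]] : exists2 z, m z & ~ Q z /\ forall P, P \in Rs -> ~ P z.
  exists z => // P; rewrite inE => /orP[/eqP -> //|PPs].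
  case: (boolP (P \in Rs)) => [/zRs//|]; rewrite mem_filter PPs andbT negbK => /asboolP PQ.
  by move/PQ.
have [Qx|Qx] := pselect (Q x); last by exists x.
have [|y] := @prime_not_sub_prod Q (m :: Rs) pQ.
  by move=> P; rewrite inE => /orP[/eqP ->//|]; rewrite mem_filter => /andP[/asboolP].
move=> yRs Qy.
have sub P : P \in m :: Rs -> P y.
  move=> PR; apply: ideal_prod_sub PR _ yRs => R; rewrite inE => /orP[/eqP ->//|/RsP[]].
  by move=> /prime_is_ideal.
have my : m y by apply: sub; rewrite mem_head.
exists (x + y); first exact: idealD.
split=> [Qxy|P PR Pxy].
  by apply: Qy; rewrite -(addKr x y) addrC; apply: idealB (prime_is_ideal pQ) Qxy Qx.
have [pP _] := RsP P PR; apply: (xRs P PR); rewrite -(addrK y x).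
by apply: idealB (prime_is_ideal pP) Pxy _; apply: sub; rewrite inE PR orbT.
Qed.

Section Noetherian.
Hypothesis A_noetherian : noetherian A.

(** Noetherian induction: a failure would produce an ascending chain, whose union is
    finitely generated. *)
Lemma noetherian_ind (T : set A -> Prop) :
  (forall J, is_ideal J -> (forall J', is_ideal J' -> J `<` J' -> T J') -> T J) ->
  forall J, is_ideal J -> T J.
Proof.
move=> step J0 iJ0; apply: contrapT => TJ0.
pose bad J := is_ideal J /\ ~ T J.
have /choice[f fP] : forall J, exists J', bad J -> bad J' /\ J `<` J'.
  move=> J; have [[iJ TJ]|nbad] := pselect (bad J); last by exists J.
  apply: contrapT => /forallNP h; apply: TJ; apply: step => // J' iJ' JJ'.
  by apply: contrapT => TJ'; apply: (h J').
pose c n := iter n f J0.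
have cbad n : bad (c n) by elim: n => [//|n /fP[]].
have clt n : c n `<` c n.+1 by have [_] := fP _ (cbad n).
have cle i j : (i <= j)%N -> c i `<=` c j.
  move=> /subnK <-; elim: (j - i)%N => [//|n IH]; rewrite addSn.
  by apply: subset_trans IH _; case: (clt (n + i)%N).
pose U := \bigcup_n c n.
have iU : is_ideal U.
  apply/is_idealP; split=> [|x y [i _ ix] [j _ jy]|a x [i _ ix]].
  - by exists 0%N => //; exact: ideal0.
  - exists (maxn i j) => //; have [iC _] := cbad (maxn i j).
    by apply: idealD => //; [apply: cle ix; exact: leq_maxl|apply: cle jy; exact: leq_maxr].
  - by exists i => //; have [iC _] := cbad i; exact: idealM.
have [s Us] := A_noetherian iU.
have [n sn] : exists n, [set` s] `<=` c n.
  have : [set` s] `<=` U by rewrite Us; exact: sub_ideal_gen.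
  elim: (s) => [|x s' IH] h; first by exists 0%N => x.
  have [|n hn] := IH; first by move=> y ys; apply: h; rewrite /= inE ys orbT.
  have [i _ ix] := h x (mem_head _ _).
  exists (maxn i n) => y /=; rewrite inE => /orP[/eqP ->|/hn].
    by apply: cle ix; exact: leq_maxl.
  by apply: cle; exact: leq_maxr.
have [_] := clt n; case; apply: (@subset_trans _ U); first by move=> x ?; exists n.+1.
by rewrite Us; apply: ideal_gen_sub => //; case: (cbad n).
Qed.

(** By Noetherian induction: if [x * y] is in [J] and neither [x] nor [y] is, then
    [(J + A x) (J + A y)] is in [J], and the families of primes for the two larger
    ideals can be concatenated. *)
Lemma prime_product J : is_ideal J -> exists Ps,
  (forall P, P \in Ps -> is_prime_ideal P /\ J `<=` P) /\ ideal_prod Ps `<=` J.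
Proof.
move: J; apply: noetherian_ind => J iJ IH.
have [J1|J1] := pselect (J 1).
  by exists [::]; split=> //; rewrite (ideal_eqT iJ J1).
have [pJ|npJ] := pselect (forall x y, J (x * y) -> J x \/ J y).
  exists [:: J]; split; last by apply: ideal_mul_sub => // x y Jx _; exact: idealMr.
  move=> P; rewrite inE => /eqP ->; split=> //; split; first exact/proper_idealP.
  by move=> x y /set_mem /pJ[] h; apply/orP; [left|right]; exact: mem_set.
have [x [y [Jxy Jx Jy]]] : exists x y, [/\ J (x * y), ~ J x & ~ J y].
  apply: contrapT => h; apply: npJ => x y Jxy; apply: contrapT => /not_orP[Jx Jy].
  by apply: h; exists x, y.
have ltJ z : ~ J z -> J `<` add_principal J z.
  move=> Jz; split; first exact: sub_add_principal.
  by move/(_ z (add_principal_mem z iJ)).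
have [Ps [hPs Psx]] := IH _ (add_principalP x iJ) (ltJ x Jx).
have [Qs [hQs Qsy]] := IH _ (add_principalP y iJ) (ltJ y Jy).
exists (Ps ++ Qs); split.
  move=> P; rewrite mem_cat => /orP[/hPs|/hQs] [pP JP]; split=> //;
    exact: subset_trans (@sub_add_principal _ _ _) JP.
have : ideal_prod (Ps ++ Qs) `<=` ideal_mul (ideal_prod Ps) (ideal_prod Qs).
  elim: (Ps) => [|P Ps' IHP].
    by move=> z Qz; rewrite -[z]mul1r; exact: ideal_mul_mem.
  apply: ideal_mul_sub (ideal_genP _) _ => u v Pu /IHP.
  have : ideal_mul (ideal_prod Ps') (ideal_prod Qs) `<=`
      colon (ideal_mul (ideal_prod (P :: Ps')) (ideal_prod Qs)) u.
    apply: ideal_mul_sub; first exact/ideal_colon/ideal_genP.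
    move=> a b Pa Qb; rewrite /colon/= mulrC mulrA.
    by apply: ideal_mul_mem => //; exact: ideal_mul_mem.
  by rewrite mulrC; apply.
move/subset_trans; apply; apply: ideal_mul_sub => // u v /Psx[u1 Ju1 [_ [a _ <-] <-]].
move=> /Qsy[v1 Jv1 [_ [b _ <-] <-]].
rewrite mulrDl; apply: idealD => //; first exact: idealMr.
rewrite mulrDr; apply: idealD => //; first exact: idealM.
by rewrite mulrACA; exact: idealM.
Qed.

Variable m : set A.
Hypothesis A_local : is_local_at m.

Let m_ideal : is_ideal m.
Proof. by case: A_local => -[/proper_idealP[]]. Qed.

Lemma maximal_sub P : is_ideal P -> ~ P 1 -> m `<=` P -> P = m.
Proof. by move=> iP P1 mP; case: A_local => -[_ mmax] _; apply: mmax => //; exact/proper_idealP. Qed.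

Lemma sub_maximal J : is_ideal J -> ~ J 1 -> J `<=` m.
Proof.
move: J; apply: noetherian_ind => J iJ IH J1.
have [[J' [iJ' JJ' J'1]]|h] := pselect (exists J', [/\ is_ideal J', J `<` J' & ~ J' 1]).
  by apply: subset_trans (IH J' iJ' JJ' J'1); case: JJ'.
case: A_local => _ /(_ J) -> //; split; first exact/proper_idealP.
move=> J' /proper_idealP[iJ' J'1] JJ'; apply: contrapT => neq; apply: h; exists J'; split=> //.
by split=> // J'J; apply: neq; apply/seteqP; split.
Qed.

Lemma maximal_prime : is_prime_ideal m.
Proof.
have m1 : ~ m 1 by case: A_local => -[/proper_idealP[]].
split; first by case: A_local => -[].
move=> x y /set_mem mxy; apply/orP.
have [mx|mx] := pselect (m x); [by left; exact: mem_set|right; apply: mem_set].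
have : add_principal m x 1.
  apply: contrapT => h1; apply: mx.
  rewrite -(maximal_sub (add_principalP x m_ideal) h1 (@sub_add_principal _ m x)).
  exact: add_principal_mem.
move=> [u mu [_ [a _ <-] E]]; rewrite -[y]mul1r -E mulrDl.
by apply: idealD => //; [exact: idealMr|rewrite -mulrA; exact: idealM].
Qed.

(** A system of parameters: choosing each parameter outside of finitely many
    primes, the primes other than [m] that contain the first [i] parameters are
    at the top of chains of length [i]; for [i = d] no such prime is left. *)
Lemma parameters_exist d : is_krull_dim A d ->
  exists ys : seq A, [/\ size ys = d, {subset ys <= [in m]} &
    exists k, ideal_pow m k `<=` ideal_gen [set` ys]].
Proof.
move=> [_ dmax].
have [ys [szys ysm ht]] : exists ys : seq A, [/\ size ys = d, {subset ys <= [in m]} &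
    forall P, is_prime_ideal P -> [set` ys] `<=` P -> P <> m ->
    exists c : nat -> set A, [/\ forall i, (i <= d)%N -> is_prime_ideal (c i),
      forall i, (i < d)%N -> c i `<` c i.+1 & c d = P]].
  move: (d) => i; elim: i => [|i [ys [szys ysm ht]]].
    by exists [::]; split=> // P pP _ _; exists (fun=> P).
  have [Ps [hPs PsJ]] := prime_product (ideal_genP [set` ys]).
  pose Qs := [seq P <- Ps | P != m].
  have [|x mx xQs] := @prime_avoidance m Qs m_ideal.
    move=> P; rewrite mem_filter => /andP[/eqP Pm /hPs[pP _]]; split=> // mP.
    by apply: Pm; apply: maximal_sub mP; [exact: prime_is_ideal|exact: prime_proper].
  exists (x :: ys); split; first by rewrite /= szys.
    by move=> y; rewrite inE => /orP[/eqP ->|/ysm//]; exact: mem_set.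
  move=> P pP xysP Pm; have iP := prime_is_ideal pP.
  have ysP : [set` ys] `<=` P by move=> y ys_y; apply: xysP; rewrite /= inE ys_y orbT.
  have [Q QPs QP] : exists2 Q, Q \in Ps & Q `<=` P.
    apply: contrapT => h; have [|y Psy Py] := @prime_not_sub_prod P Ps pP.
      by move=> Q QPs QP; apply: h; exists Q.
    by apply: Py; apply: ideal_gen_sub iP ysP _ (PsJ _ Psy).
  have [pQ JQ] := hPs Q QPs.
  have Qm : Q <> m.
    by move=> Qm; apply: Pm; apply: maximal_sub => //; [exact: prime_proper|rewrite -Qm].
  have [|c [cp clt ci]] := ht Q pQ _ Qm.
    by apply: subset_trans JQ; exact: sub_ideal_gen.
  exists (fun j => if (j <= i)%N then c j else P); split.
  - by move=> j _; case: ifP => [/cp|].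
  - move=> j; rewrite ltnS => ji; rewrite ji; case: ltnP => [/clt//|ij].
    have -> : j = i by apply/eqP; rewrite eqn_leq ij ji.
    rewrite ci; split=> // PQ; case: (xQs Q).
      by rewrite mem_filter QPs andbT; apply/eqP.
    by apply/PQ/xysP; rewrite /= mem_head.
  - by rewrite ltnn.
exists ys; split=> //; have [Ps [hPs PsJ]] := prime_product (ideal_genP [set` ys]).
exists (size Ps); apply: subset_trans PsJ.
have {hPs} : forall P, P \in Ps -> P = m.
  move=> P PPs; have [pP JP] := hPs P PPs; apply: contrapT => Pm.
  have [|c [cp clt cd]] := ht P pP _ Pm; first by apply: subset_trans JP; exact: sub_ideal_gen.
  suff /dmax : has_chain (@is_prime_ideal A) d.+1 by rewrite ltnn.
  exists (fun j => if (j <= d)%N then c j else m); split.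
    by move=> j _; case: ifP => [/cp//|_]; exact: maximal_prime.
  move=> j; rewrite ltnS => jd; rewrite jd; case: ltnP => [/clt//|dj].
  have -> : j = d by apply/eqP; rewrite eqn_leq dj jd.
  rewrite cd; have Pm' := sub_maximal (prime_is_ideal pP) (prime_proper pP).
  by split=> // mP; apply: Pm; apply/seteqP; split.
elim: (Ps) => [//|P Ps' IH] h /=; rewrite (h P (mem_head _ _)).
apply: ideal_mul_sub (ideal_genP _) _ => x y mx my; apply: ideal_mul_mem => //.
by apply: IH my => Q QPs; apply: h; rewrite inE QPs orbT.
Qed.

Lemma primary_contains_pow I : is_ideal I -> radical I = m -> exists c, ideal_pow m c `<=` I.
Proof.
move=> iI radI; have [s ms] := A_noetherian m_ideal.
have [k hk] : exists k, forall x, x \in s -> I (x ^+ k).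
  have : [set` s] `<=` radical I by rewrite radI ms; exact: sub_ideal_gen.
  elim: (s) => [|x s' IH] h; first by exists 0%N.
  have [|k hk] := IH; first by move=> y ys; apply: h; rewrite /= inE ys orbT.
  have [j Ij] := h x (mem_head _ _).
  exists (j + k)%N => y; rewrite inE exprD => /orP[/eqP ->|/hk]; first exact: idealMr.
  exact: idealM.
by exists (size s * k).+1; rewrite ms; exact: ideal_pow_sub_box iI hk (ltnSn _).
Qed.

(** Powers of [m] have finite colength by the monomial filtration for generators of
    [m], whose steps have length at most [1]. *)
Lemma has_length_pow_maximal c I : is_ideal I -> ideal_pow m c `<=` I ->
  exists L, has_length I setT L.
Proof.
move=> iI mcI; have [s ms] := A_noetherian m_ideal.
have m1 : has_length (ideal_gen [set` s]) setT 1.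
  by rewrite -ms; exact: has_length_maximal (proj1 A_local) m_ideal.
have h := has_length_pow m1 (leqnn c); rewrite -ms in h.
by have [L _ hL] := has_length_le iI (@subsetT _ _) mcI (@subset_refl _ _) h; exists L.
Qed.

(** The length of the quotient by [I ^ n] is at most the one by the [c n]-th power
    of a parameter ideal, which is bounded by the number of monomials of degree
    below [c n] in [d] variables. *)
Lemma length_pow_bound d I c : is_krull_dim A d -> is_ideal I -> ideal_pow m c `<=` I ->
  exists C, forall N n, has_length (ideal_pow I N) setT n -> (n <= C * N ^ d)%N.
Proof.
move=> dimA iI mcI; have [ys [szys ysm [k mk]]] := parameters_exist dimA.
set J := ideal_gen [set` ys] in mk.
have iJ : is_ideal J by exact: ideal_genP.
have [L hL] := has_length_pow_maximal iJ mk.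
have Jm : J `<=` m by apply: ideal_gen_sub => // y /ysm /set_mem.
exists (L * c ^ d)%N => N n hn.
have hJ := has_length_pow hL (leqnn (c * N)).
have sub : ideal_pow J (c * N) `<=` ideal_pow I N.
  apply: subset_trans (@ideal_pow_mul _ _ _ _) _; apply: ideal_pow_sub.
  by apply: subset_trans mcI; exact: ideal_pow_sub.
have [n' n'le hn'] := has_length_le (ideal_powP I N) (@subsetT _ _) sub (@subset_refl _ _) hJ.
rewrite (max_chain_uniq hn hn'); apply: leq_trans n'le _.
apply: (@leq_trans (boxsum (size ys) (fun=> L) (c * N) (c * N))).
  by apply: boxsum_le => a sa; exact: lead_length_max.
rewrite -mulnA -expnMn -szys.
have -> : boxsum (size ys) (fun=> L) (c * N) (c * N) =
    (L * boxcount (size ys) (c * N) (c * N))%N.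
  by rewrite /boxcount /boxsum big_distrr /=; apply: eq_bigr => a _; rewrite muln1.
by rewrite leq_mul2l boxcount_le orbT.
Qed.

End Noetherian.
End Primes.

(** * Multiplicities *)

Section Limits.
Variable K : realType.
Implicit Types (u : nat -> K).

(** [limn] takes the value [0] on divergent sequences, so a nonzero value of [limn]
    certifies convergence. *)
Lemma limn_divergent u : ~ cvgn u -> limn u = 0.
Proof.
move=> ncvg; rewrite /lim /lim_in /= xgetPN// => l ul.
by apply: ncvg; apply/cvg_ex; exists l.
Qed.

Lemma cvg_subseq u (phi : nat -> nat) (l : K) : (forall e, (e <= phi e)%N) ->
  u @ \oo --> l -> (fun e => u (phi e)) @ \oo --> l.
Proof.
move=> phi_ge ul P /ul [N _ hN]; exists N => // e /= Ne; apply: hN.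
exact: leq_trans Ne (phi_ge e).
Qed.

Lemma cvg_eq u v (l : K) : u =1 v -> u @ \oo --> l -> v @ \oo --> l.
Proof. by move=> /funext ->. Qed.

(** The error term is [O(1 / n)] after division by [n ^ (k + 1)]. *)
Lemma asymptotic_cvg k (f : nat -> nat -> K) (E s : K) : 0 < s ->
  negligible k.+1 (fun q N => f q N - E * (boxcount k.+1 q N)%:R) ->
  (fun n => f n (ceiln (s * n%:R)) / n%:R ^+ k.+1) @ \oo --> E * H_norm k.+1 s.
Proof.
move=> s0 [C hC]; pose N n := ceiln (s * n%:R).
pose r n := (f n (N n) - E * (boxcount k.+1 n (N n))%:R) / n%:R ^+ k.+1.
have rE : (fun n => f n (N n) / n%:R ^+ k.+1) =
    r + (fun n => E * ((boxcount k.+1 n (N n))%:R / n%:R ^+ k.+1)).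
  by apply/funext => n; rewrite fctE /r mulrA -mulrDl subrK.
rewrite rE -[E * _]add0r; apply: cvgD; last first.
  by apply: cvgM; [exact: cvg_cst|exact: cvg_boxcount].
apply/norm_cvg0P.
have upper : (fun n : nat => C * n%:R^-1 : K) @ \oo --> C * 0.
  by apply: cvgM; [exact: cvg_cst|exact: cvg_natV].
rewrite mulr0 in upper.
apply: squeeze_cvgr (cvg_cst 0) upper; apply: near_pos => n n0.
have np : 0 < n%:R :> K by rewrite ltr0n.
rewrite normr_ge0 /= /r normrM normfV normrX normr_nat ler_pdivrMr ?exprn_gt0//.
by rewrite exprS mulrA mulfVK ?gt_eqF// hC.
Qed.

End Limits.

Section Comparison.
Variables (K : realType) (A : comNzRingType) (xs : seq A) (L : nat).
Let I := ideal_gen [set` xs].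
Hypothesis IL : has_length I setT L.
Let n := size xs.
Let f q N := boxsum n (lead_length xs) q N.
Let V q N := length_quot (ideal_sum (ideal_pow I N) (frobenius_pow I q)).
Let W q := length_quot (frobenius_pow I q).

Let iI : is_ideal I. Proof. exact: ideal_genP. Qed.
Let iF q : is_ideal (frobenius_pow I q). Proof. exact: ideal_genP. Qed.

Let frob_var q x : x \in xs -> frobenius_pow I q (x ^+ q).
Proof. by move=> xxs; apply: sub_ideal_gen; exists x => //; exact: sub_ideal_gen. Qed.

Lemma frobenius_sub_pow (J : set A) q : frobenius_pow J q `<=` ideal_pow J q.
Proof.
apply: ideal_gen_sub; first exact: ideal_powP.
move=> _ [x Jx <-]; elim: q => [//|q IH].
by rewrite exprS; exact: ideal_mul_mem.
Qed.

Lemma length_pow_boxsum N q : (N <= q)%N -> length_quot (ideal_pow I N) = f q N.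
Proof. by move=> Nq; apply: length_quotE; exact: (has_length_pow IL Nq). Qed.

(** A box of side [q] contains no exponent of degree above [n q]. *)
Lemma boxsum_lead_bound d C :
  (forall N k, has_length (ideal_pow I N) setT k -> (k <= C * N ^ d)%N) ->
  forall q N, (0 < q)%N -> (f q N <= C * n.+1 ^ d * q ^ d)%N.
Proof.
move=> hC q N q0; set M := (n.+1 * q)%N.
have nqM : (n * q < M)%N by rewrite /M mulSn; lia.
have qM : (q <= M)%N by rewrite leq_pmull.
rewrite -mulnA -expnMn -/M; apply: leq_trans (hC M _ (has_length_pow IL (leqnn M))).
apply: (@leq_trans (f q M)); last exact: boxsum_mono.
rewrite /f (_ : boxsum n _ q N = boxsum n (lead_length xs) q (minn N M)).
  by apply: boxsum_mono => //; exact: geq_minr.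
apply: perm_big; apply: uniq_perm; rewrite ?box_uniq// => a.
rewrite !mem_box leq_min; case: eqP => //= sa; case: (boolP (all _ _)) => //= h.
by rewrite [X in _ && X](leq_ltn_trans (leq_sumn_box h) _) ?andbT// sa.
Qed.

(** Each layer of [V q] is at most the corresponding layer of [f q], so the difference
    [f q N - V q N] is nondecreasing in [N]. *)
Lemma length_sub_boxsum q N M : (N <= M)%N -> (V q M + f q N <= V q N + f q M)%N.
Proof.
have [U [UP _ US]] := has_length_pow_box IL (iF q) (@frob_var q).
have VU k : V q k = U k by exact: length_quotE.
move=> /subnK <-; elim: (M - N)%N => [//|j IH].
rewrite !VU in IH *; rewrite addSn /f /boxsum big_box_layer addnA.
apply: leq_trans (leq_add IH (leqnn _)); rewrite addnAC leq_add2r.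
exact: US.
Qed.

Lemma length_le_boxsum q N : (V q N <= f q N)%N.
Proof.
have := length_sub_boxsum q (leq0n N); rewrite /f.
have -> : V q 0 = 0%N.
  rewrite /V (_ : ideal_sum _ _ = setT); first exact/length_quotE/has_length_id/ideal_setT.
  apply: ideal_eqT; first by apply: ideal_sumP => //; exact: ideal_setT.
  exact: ideal_suml.
by rewrite add0n; apply: leq_trans; exact: leq_addr.
Qed.

Lemma length_large q N : (n * q < N)%N -> V q N = W q.
Proof.
move=> nqN; rewrite /V ideal_sum_absorb//; first exact: ideal_powP.
by apply: (ideal_pow_sub_box (q := q)) => // x; exact: frob_var.
Qed.

Lemma length_diag q : V q q = f q q.
Proof.
rewrite /V ideal_sum_absorbr//; [exact: length_pow_boxsum|exact: ideal_powP|].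
exact: frobenius_sub_pow.
Qed.

Section Limit.
Variables (p k : nat) (E : K).
Hypothesis p_gt1 : (1 < p)%N.
Hypothesis f_asymptotic : negligible k.+1 (fun q N => (f q N)%:R - E * (boxcount k.+1 q N)%:R).

Let f_cvg s : 0 < s -> (fun m => (f m (ceiln (s * m%:R)))%:R / m%:R ^+ k.+1) @ \oo --> E * H_norm k.+1 s.
Proof. by move=> s0; exact: (asymptotic_cvg s0 f_asymptotic). Qed.

Let f_cvg_p s : 0 < s ->
  (fun e => (f (p ^ e) (ceiln (s * (p ^ e)%:R)))%:R / (p ^ (e * k.+1))%:R) @ \oo --> E * H_norm k.+1 s.
Proof.
move=> s0; have := cvg_subseq (phi := expn p) (fun e => ltnW (ltn_expl e p_gt1)) (f_cvg s0).
by under eq_fun do rewrite -natrX -expnM.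
Qed.

Lemma hilbert_samuel_multE : hilbert_samuel_mult K k.+1 I = E.
Proof.
apply/cvg_lim => //; have := f_cvg ltr01; rewrite H_norm1//.
have f0 : (k.+1`!)%:R != 0 :> K by rewrite pnatr_eq0 -lt0n fact_gt0.
move=> h; rewrite -[E](_ : (k.+1`!)%:R * (E / (k.+1`!)%:R) = _); last first.
  by rewrite mulrCA mulfV// mulr1.
apply: cvg_eq (cvgM (cvg_cst ((k.+1`!)%:R : K)) h) => m /=.
by rewrite mul1r ceiln_nat (length_pow_boxsum (leqnn m)) mulrA.
Qed.

Lemma s_mult1 : s_mult p k.+1 I 1 = E.
Proof.
rewrite /s_mult /s_mult2.
have H0 : H_norm k.+1 (1 : K) != 0 by rewrite gt_eqF// H_norm_gt0.
have -> : h_mult p k.+1 I I 1 = E * H_norm k.+1 1; last by rewrite mulfK.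
apply/cvg_lim => //; apply: cvg_eq (f_cvg_p ltr01) => e.
rewrite -/(ceiln (1 * (p ^ e)%:R)) mul1r ceiln_nat.
by rewrite -[length_quot _]/(V _ _) length_diag.
Qed.

Lemma s_mult_large j : (k < j)%N -> (n < j)%N ->
  s_mult p k.+1 I j%:R = hilbert_kunz_mult K p k.+1 I.
Proof.
move=> kj nj; rewrite /s_mult /s_mult2 H_norm_large// divr1 /h_mult /hilbert_kunz_mult.
congr (limn _); apply/funext => e; rewrite -/(ceiln (j%:R * (p ^ e)%:R)) -natrM ceiln_nat.
rewrite -[length_quot (ideal_sum _ _)]/(V _ _) length_large//.
by rewrite ltn_pmul2r// expn_gt0 (ltnW p_gt1).
Qed.

(** If [E] is not [0], then the limit defining the Hilbert-Kunz multiplicity is not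
    the value [0] of a divergent sequence; if [E] is [0], then the sequence is
    dominated by one that tends to [0]. *)
Lemma hilbert_kunz_cvg : hilbert_kunz_mult K p k.+1 I = E ->
  (fun e => (W (p ^ e))%:R / (p ^ (e * k.+1))%:R) @ \oo --> E.
Proof.
move=> eHK; have [E0|E0] := eqVneq E 0; last first.
  have wcvg : cvgn (fun e => (W (p ^ e))%:R / (p ^ (e * k.+1))%:R : K).
    by apply: contrapT => /limn_divergent; rewrite -[LHS]/(hilbert_kunz_mult K p k.+1 I) eHK; exact/eqP.
  by rewrite -[X in _ --> X]eHK.
pose j := (maxn k n).+1.
have := f_cvg_p (ltr0n K j); rewrite E0 mul0r => upper.
apply: squeeze_cvgr (cvg_cst 0) upper; apply: nearW => e.
rewrite divr_ge0//= ler_pM2r ?invr_gt0 ?ltr0n ?expn_gt0 ?(ltnW p_gt1)// ler_nat.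
rewrite -natrM ceiln_nat -(@length_large (p ^ e) (j * p ^ e)) ?length_le_boxsum//.
by rewrite ltn_pmul2r ?expn_gt0 ?(ltnW p_gt1)// ltnS leq_maxr.
Qed.

(** The squeeze between [W q - (f q (j q) - f q N)] and [f q N], for [N] the ceiling of
    [s q] and an integer [j] so large that [V q (j q) = W q] and [N <= j q]. *)
Lemma s_multE s : 0 < s -> hilbert_kunz_mult K p k.+1 I = E -> s_mult p k.+1 I s = E.
Proof.
move=> s0 eHK; rewrite /s_mult /s_mult2.
have H0 : H_norm k.+1 s != 0 by rewrite gt_eqF// H_norm_gt0.
suff -> : h_mult p k.+1 I I s = E * H_norm k.+1 s by rewrite mulfK.
apply/cvg_lim => //.
pose j := maxn (maxn k n).+1 (ceiln s).
have jk : (k < j)%N by rewrite /j leq_max ltnS leq_maxl.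
have jn : (n < j)%N by rewrite /j leq_max ltnS leq_maxr.
have sj : s <= j%:R.
  have /andP[h _] := ceiln_itv (ltW s0); apply: le_trans h _.
  by rewrite ler_nat leq_maxr.
have j0 : 0 < j%:R :> K by exact: lt_le_trans sj.
have upper := f_cvg_p s0.
have lower : (fun e => (W (p ^ e))%:R / (p ^ (e * k.+1))%:R +
      (f (p ^ e) (ceiln (s * (p ^ e)%:R)))%:R / (p ^ (e * k.+1))%:R -
      (f (p ^ e) (ceiln (j%:R * (p ^ e)%:R : K)))%:R / (p ^ (e * k.+1))%:R) @ \oo -->
    E * H_norm k.+1 s.
  have <- : E + E * H_norm k.+1 s - E * H_norm k.+1 j%:R = E * H_norm k.+1 s.
    by rewrite H_norm_large// mulr1 addrAC subrr add0r.
  by apply: cvgB; [apply: cvgD => //; exact: hilbert_kunz_cvg|exact: f_cvg_p].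
apply: squeeze_cvgr lower upper; apply: nearW => e /=.
have q0 : (0 < p ^ e)%N by rewrite expn_gt0 (ltnW p_gt1).
have pk0 : 0 < ((p ^ (e * k.+1))%:R : K)^-1 by rewrite invr_gt0 ltr0n expn_gt0 (ltnW p_gt1).
rewrite -/(ceiln (s * (p ^ e)%:R)) -[length_quot (ideal_sum _ _)]/(V _ _).
rewrite -mulrDl -mulrBl !ler_pM2r// ler_nat length_le_boxsum andbT.
rewrite lerBlDr -!natrD ler_nat.
have h : (ceiln (s * (p ^ e)%:R) <= ceiln (j%:R * (p ^ e)%:R : K))%N.
  by apply: ceiln_le; [rewrite mulr_ge0// ltW|rewrite ler_wpM2r].
have := length_sub_boxsum (p ^ e) h; rewrite -natrM ceiln_nat length_large//.
by rewrite ltn_pmul2r.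
Qed.

End Limit.
End Comparison.

Theorem corollary3p5 (K : realType) (A : idomainType) (m : set A) (p d : nat)
    (I : set A)
    (A_noetherian : noetherian A)
    (A_local : is_local_at m)
    (A_complete : adically_complete m)
    (A_char : p \in [pchar A])
    (A_dim : is_krull_dim A d)
    (d_ge2 : (2 <= d)%N)
    (I_primary : is_primary_to m I) :
  (exists c : K, forall s : K, 0 < s -> s_mult p d I s = c) <->
  hilbert_kunz_mult K p d I = hilbert_samuel_mult K d I.
Proof.
have p_gt1 : (1 < p)%N by apply: prime_gt1; exact: pcharf_prime A_char.
case: I_primary => -[/proper_idealP[iI _] _] radI.
have [c mcI] := primary_contains_pow A_noetherian A_local iI radI.
have [L IL] := has_length_pow_maximal A_noetherian A_local iI mcI.
have [C hC] := length_pow_bound A_noetherian A_local A_dim iI mcI.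
have [xs xsI] := A_noetherian I iI; rewrite {}xsI in IL hC *.
case: d d_ge2 A_dim hC => [//|k] _ _ hC.
have f_noninc : noninc (size xs) (lead_length xs).
  by move=> a b; exact: (lead_length_noninc IL).
have [E fE] := @boxsum_asymptotic K _ _ _ _ f_noninc (boxsum_lead_bound IL hC).
rewrite (hilbert_samuel_multE IL fE); split=> [[e he]|eHK].
  pose j := (maxn k (size xs)).+1.
  rewrite -(@s_mult_large K A xs p k p_gt1 j) ?ltnS ?leq_maxl ?leq_maxr//.
  by rewrite he ?ltr0n// -(he 1 ltr01) (s_mult1 IL p_gt1 fE).
by exists E => s s0; exact: (s_multE IL p_gt1 fE s0 eHK).
Qed.
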